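(* With $S(\rho|\sigma)=S_{11}(z;\rho|\sigma)$ and $H_c(z,q)$ as defined in the context, the following fifteen identities of formal series in $z$ and $q$ hold: $$\begin{aligned} H_{(8,0,0)}(z,q)&=S((1,1,1)|(1,1,1)),\\ H_{(7,1,0)}(z,q)&=S((0,1,1)|(1,1,1)),\\ H_{(7,0,1)}(z,q)&=S((1,1,1)|(0,1,1))-q(1-z)S((2,1,1)|(1,1,1)),\\ H_{(6,2,0)}(z,q)&=S((0,0,1)|(1,1,1)),\\ H_{(6,1,1)}(z,q)&=S((0,1,1)|(0,1,1))-qS((1,1,1)|(1,1,1)),\\ H_{(6,0,2)}(z,q)&=S((1,1,1)|(0,0,1))-q(1-z)S((2,1,1)|(0,1,1)),\\ H_{(5,3,0)}(z,q)&=S((0,0,0)|(1,1,1)),\\ H_{(5,2,1)}(z,q)&=S((0,0,1)|(0,1,1))-qS((0,1,1)|(1,1,1)),\\ H_{(5,1,2)}(z,q)&=S((0,1,1)|(0,0,1))-qS((1,1,1)|(0,1,1)),\\ H_{(5,0,3)}(z,q)&=S((1,1,1)|(0,0,0))-q(1-z)S((2,1,1)|(0,0,1)),\\ H_{(4,3,1)}(z,q)&=S((0,0,0)|(0,1,1))-qS((0,0,1)|(1,1,1)),\\ H_{(4,2,2)}(z,q)&=S((0,0,1)|(0,0,1))-qS((0,1,1)|(0,1,1)),\\ H_{(4,1,3)}(z,q)&=S((0,1,1)|(0,0,0))-qS((1,1,1)|(0,0,1)),\\ H_{(3,3,2)}(z,q)&=S((0,0,0)|(0,0,1))-qS((0,0,1)|(0,1,1)),\\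 H_{(4,4,0)}(z,q)&=S((1,0,0)|(0,1,1))-qS((1,0,1)|(1,1,1))+qz\,S((2,1,1)|(0,0,0)). \end{aligned}$$
   Context: For an integer $L\ge0$, $(a;q)_L:=(1-a)(1-aq)\cdots(1-aq^{L-1})$ and $(a;q)_\infty:=\lim_{L\to\infty}(a;q)_L$. Cylindric partitions. A profile is a finite list $c=(c_1,\dots,c_r)$ of non-negative integers. A cylindric partition with profile $c$ is a vector $\pi=(\pi^{(1)},\dots,\pi^{(r)})$ of $r$ integer partitions $\pi^{(i)}=(\pi^{(i)}_1\ge\pi^{(i)}_2\ge\cdots)$ (extended by zeros) satisfying, for all $j\ge1$, $\pi^{(i)}_j\ge\pi^{(i+1)}_{j+c_{i+1}}$ for $1\le i\le r-1$, and $\pi^{(r)}_j\ge\pi^{(1)}_{j+c_1}$. Let $\mathcal P_c$ be the set of these, $|\pi|$ the sum of all parts of all $\pi^{(i)}$, and $\max(\pi)$ the largest part occurring in $\pi$ ($0$ if all $\pi^{(i)}$ are empty). Put $$F_c(z,q):=\sum_{\pi\in\mathcal P_c}z^{\max(\pi)}q^{|\pi|},\qquad H_c(z,q):=\frac{(zq;q)_\infty}{(q;q)_\infty}F_c(z,q).$$ Sums. For $\rho=(\rho_1,\rho_2,\rho_3),\ \sigma=(\sigma_1,\sigma_2,\sigma_3)\in\mathbb Z^3$, $$S_{11}(z;\rho|\sigma):=\sum_{\substack{r_1\ge r_2\ge r_3\ge0\\ s_1\ge s_2\ge s_3\ge0}} z^{r_1}\,\frac{q^{\sum_{i=1}^{3}(r_i^2-r_is_i+s_i^2+\rho_ir_i+\sigma_is_i)}\;q^{2r_3s_3}}{(q;q)_{r_1-r_2}(q;q)_{r_2-r_3}(q;q)_{s_1-s_2}(q;q)_{s_2-s_3}(q;q)_{r_3}(q;q)_{s_3}(q;q)_{r_3+s_3+1}}.$$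 *)

(* Defs.v *)
From HB Require Import structures.
From mathcomp Require Import all_boot all_order all_algebra.
From mathcomp Require Import boolp classical_sets functions cardinality fsbigop.

Set Implicit Arguments.
Unset Strict Implicit.
Unset Printing Implicit Defensive.

Import GRing.Theory.
Local Open Scope ring_scope.

(* Formal power series.  The library has none, so they are built here: an
   [a : fps R] is the sequence of its coefficients, with the Cauchy product. *)

Record fps (R : Type) := Fps { fps_coef :> nat -> R }.

HB.instance Definition _ (R : Type) := gen_eqMixin (fps R).
HB.instance Definition _ (R : Type) := gen_choiceMixin (fps R).

Lemma fpsP (R : Type) (a b : fps R) : a =1 b <-> a = b.
Proof.
by split=> [|->//]; case: a b => [a] [b] /= ab; congr Fps; apply/funext.
Qed.

Section FpsZmodule.
Variable R : zmodType.

Definition fps_zero : fps R := Fps (fun=> 0).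
Definition fps_opp (a : fps R) : fps R := Fps (fun n => - a n).
Definition fps_add (a b : fps R) : fps R := Fps (fun n => a n + b n).

Fact fps_addA : associative fps_add.
Proof. by move=> a b c; apply/fpsP => n /=; rewrite addrA. Qed.
Fact fps_addC : commutative fps_add.
Proof. by move=> a b; apply/fpsP => n /=; rewrite addrC. Qed.
Fact fps_add0 : left_id fps_zero fps_add.
Proof. by move=> a; apply/fpsP => n /=; rewrite add0r. Qed.
Fact fps_addN : left_inverse fps_zero fps_opp fps_add.
Proof. by move=> a; apply/fpsP => n /=; rewrite addNr. Qed.

HB.instance Definition _ :=
  GRing.isZmodule.Build (fps R) fps_addA fps_addC fps_add0 fps_addN.

End FpsZmodule.

Section FpsRing.
Variable R : comNzRingType.

Definition fpsC (c : R) : fps R := Fps (fun n => if n == 0%N then c else 0).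
Definition fpsX : fps R := Fps (fun n => (n == 1%N)%:R).
Definition fps_mul (a b : fps R) : fps R :=
  Fps (fun n => \sum_(i < n.+1) a i * b (n - i)%N).

Let trunc n (a : fps R) : {poly R} := \poly_(i < n.+1) a i.

Let mul_trunc n (a b : fps R) i :
  (i <= n)%N -> fps_mul a b i = (trunc n a * trunc n b)`_i.
Proof.
move=> le_in; rewrite coefM /=; apply: eq_bigr => j _.
rewrite !coef_poly !ltnS (leq_trans (leq_subr _ _) le_in).
by rewrite (leq_trans _ le_in) // -ltnS.
Qed.

Fact fps_mulC : commutative fps_mul.
Proof.
by move=> a b; apply/fpsP => n; rewrite !(mul_trunc _ _ (leqnn n)) mulrC.
Qed.

Fact fps_mulA : associative fps_mul.
Proof.
move=> a b c; apply/fpsP => n; rewrite !(mul_trunc _ _ (leqnn n)).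
transitivity ((trunc n a * trunc n b * trunc n c)`_n); last first.
  rewrite !coefM; apply: eq_bigr => i _; congr (_ * _).
  by rewrite coef_poly ltn_ord (@mul_trunc n) // -ltnS.
rewrite -mulrA !coefM; apply: eq_bigr => i _; congr (_ * _).
by rewrite coef_poly ltnS leq_subr (@mul_trunc n) // leq_subr.
Qed.

Fact fps_mul1 : left_id (fpsC 1) fps_mul.
Proof.
move=> a; apply/fpsP => n /=; rewrite big_ord_recl /= mul1r subn0.
by rewrite big1 ?addr0 // => i _; rewrite mul0r.
Qed.

Fact fps_mulDl : left_distributive fps_mul +%R.
Proof.
move=> a b c; apply/fpsP => n /=; rewrite -big_split /=.
by apply: eq_bigr => i _; rewrite mulrDl.
Qed.

Fact fps_1neq0 : fpsC 1 != 0.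
Proof.
by apply/eqP => /fpsP /(_ 0%N) /= /eqP; rewrite oner_eq0.
Qed.

HB.instance Definition _ := GRing.Zmodule_isComNzRing.Build (fps R)
  fps_mulA fps_mulC fps_mul1 fps_mulDl fps_1neq0.

Definition fps_unit : {pred fps R} := fun a => `[< exists b, b * a = 1 >].
Definition fps_inv (a : fps R) : fps R := xget a [set b | b * a = 1].

Fact fps_mulV : {in fps_unit, left_inverse 1 fps_inv *%R}.
Proof. by move=> a /asboolP; exact: xgetPex. Qed.
Fact fps_unitPl a b : b * a = 1 -> fps_unit a.
Proof. by move=> ba1; apply/asboolP; exists b. Qed.
Fact fps_inv_out : {in [predC fps_unit], fps_inv =1 id}.
Proof.
by move=> a /asboolP Ua; apply: xgetPN => b ba1; apply: Ua; exists b.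
Qed.

HB.instance Definition _ := GRing.ComNzRing_hasMulInverse.Build (fps R)
  fps_mulV fps_unitPl fps_inv_out.

End FpsRing.

Lemma fps_unitE (R : comUnitRingType) (a : fps R) :
  (a \is a GRing.unit) = (a 0%N \is a GRing.unit).
Proof.
apply/idP/idP => [/asboolP[b /fpsP /(_ 0%N)] /= | Ua0].
  by rewrite big_ord1 subn0 => ba1; apply/unitrPr; exists (b 0%N); rewrite mulrC.
pose next (s : seq R) :=
  - (\sum_(i < size s) s`_i * a (size s - i)%N) / a 0%N.
pose pre n := iter n (fun s => rcons s (next s)) [:: (a 0%N)^-1].
have szp n : size (pre n) = n.+1 by elim: n => //= n IH; rewrite size_rcons IH.
have stab n m i : (i <= n)%N -> (pre (m + n)%N)`_i = (pre n)`_i.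
  move=> le_in; elim: m => //= m IH.
  by rewrite nth_rcons szp ltnS (leq_trans le_in) ?leq_addl.
apply/asboolP; exists (Fps (fun n => (pre n)`_n)).
apply/fpsP => -[|n]; first by rewrite /= big_ord1 /= mulVr.
rewrite /= big_ord_recr /= subnn nth_rcons szp ltnn eqxx /next szp.
rewrite divrK // addrC; apply/eqP; rewrite addrC subr_eq0; apply/eqP.
apply: eq_bigr => i _; congr (_ * _).
by have /= := @stab i (n - i)%N i (leqnn i); rewrite subnK // -ltnS.
Qed.

(* Formal series in z and q, i.e. Z[[q]][[z]]: [a i j] is the coefficient of
   z^i q^j in [a]. *)

Notation series := (fps (fps int)).

Definition q : series := fpsC (fpsX int).
Definition z : series := fpsX (fps int).

(* Limits and infinite sums are taken coefficientwise: each coefficient must be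
   eventually constant, resp. receive finitely many nonzero contributions (a
   [\sum_(x \in A)] of infinite support is 0).  This is the case for every limit
   and sum used below. *)

Definition series_lim (u : nat -> series) : series :=
  Fps (fun i => Fps (fun j =>
    xget 0 [set a | exists N, forall n, (N <= n)%N -> u n i j = a])).

Definition series_sum (T : choiceType) (A : set T) (f : T -> series) : series :=
  Fps (fun i => Fps (fun j => \sum_(x \in A) f x i j)).

(* (a;q)_L and (a;q)_oo *)
Definition qpoch (a : series) (L : nat) : series :=
  \prod_(k < L) (1 - a * q ^+ k).
Definition qpoch_inf (a : series) : series := series_lim (qpoch a).

(* A partition is the list of its positive parts, extended by zeros by [nth].
   All indices, including those of [c], start at 0. *)

Definition is_partition (p : seq nat) : bool := sorted geq p && (0%N \notin p).

Definition part (pi : seq (seq nat)) (i j : nat) : nat :=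
  nth 0%N (nth [::] pi i) j.

Definition cylindric (c : seq nat) : set (seq (seq nat)) :=
  [set pi | [/\ size pi = size c,
    all is_partition pi,
    forall i j, (i.+1 < size c)%N ->
      (part pi i j >= part pi i.+1 (j + nth 0 c i.+1))%N &
    forall j,
      (part pi (size c).-1 j >= part pi 0 (j + nth 0 c 0))%N]].

Definition weight (pi : seq (seq nat)) : nat := (\sum_(p <- pi) \sum_(x <- p) x)%N.
Definition max_part (pi : seq (seq nat)) : nat :=
  (\max_(p <- pi) \max_(x <- p) x)%N.

Definition F (c : seq nat) : series :=
  series_sum (cylindric c) (fun pi => z ^+ max_part pi * q ^+ weight pi).

Definition H (c : seq nat) : series :=
  qpoch_inf (z * q) / qpoch_inf q * F c.

(* The quadratic form and the shifts rho, sigma.  The subtraction of naturals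
   does not truncate, as r s <= r^2 + s^2.  The shifts are restricted to
   naturals: negative ones would lead to Laurent series in q. *)

Definition term_exp (r s rho sigma : nat) : nat :=
  (r ^ 2 + s ^ 2 - r * s + rho * r + sigma * s)%N.

Definition S11_term (rho sigma r s : nat * nat * nat) : series :=
  let: (rho1, rho2, rho3) := rho in
  let: (sigma1, sigma2, sigma3) := sigma in
  let: (r1, r2, r3) := r in
  let: (s1, s2, s3) := s in
  z ^+ r1 *
  (q ^+ (term_exp r1 s1 rho1 sigma1 + term_exp r2 s2 rho2 sigma2
         + term_exp r3 s3 rho3 sigma3) * q ^+ (2 * r3 * s3)) /
  (qpoch q (r1 - r2) * qpoch q (r2 - r3) * qpoch q (s1 - s2) * qpoch q (s2 - s3)
   * qpoch q r3 * qpoch q s3 * qpoch q (r3 + s3 + 1)).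

Definition nonincr3 (r : nat * nat * nat) : Prop :=
  let: (r1, r2, r3) := r in (r3 <= r2 <= r1)%N.

Definition S11 (rho sigma : nat * nat * nat) : series :=
  series_sum [set rs : (nat * nat * nat) * (nat * nat * nat) |
              nonincr3 rs.1 /\ nonincr3 rs.2]
             (fun rs => S11_term rho sigma rs.1 rs.2).

(* Main.v *)
From HB Require Import structures.
Require Import Defs.
From mathcomp Require Import all_boot all_order all_algebra ring zify.
From mathcomp Require Import boolp classical_sets functions cardinality fsbigop.

Set Implicit Arguments.
Unset Strict Implicit.
Unset Printing Implicit Defensive.

Import GRing.Theory.
Local Open Scope ring_scope.

(** Let S stand for S11.  Removing the largest part from the components in which
    it occurs shows, by inclusion-exclusion, that the series H_c satisfy the
    Corteel-Welsh recursion
      H_c(z) = sum_J (-1)^(|J|-1) (zq;q)_(|J|-1) H_(c(J))(z q^|J|),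
    where J runs over the nonempty sets of indices i with c_i > 0.  As
    J is nonempty, the coefficient of z^n q^j is determined for n > 0 by smaller
    ones, so the recursion has at most one solution with given value at z = 0,
    which is 1/(q;q)_oo for the H_c.  The right-hand sides have the same value
    at z = 0, by iterating the q-Chu-Vandermonde sum, and they satisfy the same
    recursion: z -> zq amounts to increasing rho_1, so each of the fifteen
    recursions is a linear relation between values of S, and it is a linear
    combination with coefficients in Z[z, q] of six contiguity relations. *)

(** * Contiguity relations and their consequences *)

(* [T a1 a2 a3 b1 b2 b3] stands for q^3 S(a1-1, a2-1, a3-1 | b1-1, b2-1, b3-1):
   shifts equal to -1 occur in the proof, and q^3 clears the negative powers
   of q. *)

(** The recursion for one profile involves other profiles of the same level 8, so on this route no
    identity can be proved alone: the induction closes only on the whole system. There are 45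
    profiles of level 8, and since 3 does not divide 8 each orbit under rotation has three elements;
    the fifteen profiles of the theorem are one representative of each orbit. The right-hand sides
    are therefore extended to all 45 profiles by rotation, and the rotation invariance of H_c comes
    out of uniqueness. The algebra is done over an arbitrary commutative ring, with an unknown
    family T that satisfies the contiguity relations. Each recursion then becomes a polynomial
    identity in z, q and values of T, which [ring] can check; convergence enters only when T is
    instantiated by the actual sums. *)

Section Contiguity.
Variables (R : comNzRingType) (q : R).
Implicit Types (z : R) (T : nat -> nat -> nat -> nat -> nat -> nat -> R).

(* Multiplying the summand of S by 1 - q^(r1-r2), resp. 1 - q^(r2-r3), resp.
   (1 - q^r3)(1 - q^(r3+s3+1)), and shifting r1, resp. r1 and r2, resp. all the
   r_i by one. *)
Definition relA1 z T a1 a2 a3 b1 b2 b3 :=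
  T a1 a2.+1 a3 b1.+1 b2 b3 - T a1.+1 a2 a3 b1.+1 b2 b3
  - z * q ^+ a1 * T a1.+2 a2.+1 a3 b1 b2 b3.
Definition relA2 z T a1 a2 a3 b1 b2 b3 :=
  T a1 a2 a3.+1 b1.+1 b2.+1 b3 - T a1 a2.+1 a3 b1.+1 b2.+1 b3
  - z * (q ^+ a1 * q ^+ a2) * T a1.+2 a2.+2 a3.+1 b1 b2 b3.
Definition relA3 z T a1 a2 a3 b1 b2 b3 :=
  T a1 a2 a3 b1.+1 b2.+1 b3 - T a1 a2 a3.+1 b1.+1 b2.+1 b3
  - q * T a1 a2 a3.+1 b1.+1 b2.+1 b3.+1 + q * T a1 a2 a3.+2 b1.+1 b2.+1 b3.+1
  - z * (q ^+ a1 * q ^+ a2 * q ^+ a3) * T a1.+2 a2.+2 a3.+2 b1 b2 b3.+1.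
Definition swap T a1 a2 a3 b1 b2 b3 := T b1 b2 b3 a1 a2 a3.

Definition contiguous z T := forall a1 a2 a3 b1 b2 b3,
  [/\ relA1 z T a1 a2 a3 b1 b2 b3 = 0, relA2 z T a1 a2 a3 b1 b2 b3 = 0
    & relA3 z T a1 a2 a3 b1 b2 b3 = 0].
Definition shift T a1 := T a1.+1.

(* The summand of S is symmetric in r and s, except for z^r1. *)
Definition bicontiguous z T := contiguous z T /\ contiguous 1 (swap T).

(** On the r side z q^(a1+1) = (zq) q^a1 absorbs the shift. On the s side the shifted index is
    raised uniformly in all terms of the relation, and the variable stays 1. *)
Lemma bicontiguous_shift z T :
  bicontiguous z T -> bicontiguous (z * q) (shift T).
Proof.
case=> cA cB; split=> [a1 a2 a3 b1 b2 b3|a1 a2 a3 b1 b2 b3].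
  have [A1 A2 A3] := cA a1.+1 a2 a3 b1 b2 b3.
  rewrite -[RHS]A1 -[in X in [/\ _, X & _]]A2 -[in X in [/\ _, _ & X]]A3.
  by rewrite /relA1 /relA2 /relA3 /shift !exprS; split; ring.
have [B1 B2 B3] := cB a1 a2 a3 b1.+1 b2 b3.
by rewrite /relA1 /relA2 /relA3 /swap /shift in B1 B2 B3 *; split.
Qed.

Lemma bicontiguous_iter z T k :
  bicontiguous z T -> bicontiguous (z * q ^+ k) (iter k shift T).
Proof.
move=> zT; elim: k => [|k IH]; first by rewrite mulr1.
by rewrite exprSr mulrA; exact: bicontiguous_shift.
Qed.

(* q^3 times the right-hand sides of the theorem. *)
Definition rep_sum z T (c1 c2 c3 : nat) : R :=
  match c1, c2, c3 with
  | 8, 0, 0 => (T 2 2 2 2 2 2)%R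
  | 7, 1, 0 => (T 1 2 2 2 2 2)%R
  | 7, 0, 1 => (T 2 2 2 1 2 2 - q * (1 - z) * T 3 2 2 2 2 2)%R
  | 6, 2, 0 => (T 1 1 2 2 2 2)%R
  | 6, 1, 1 => (T 1 2 2 1 2 2 - q * T 2 2 2 2 2 2)%R
  | 6, 0, 2 => (T 2 2 2 1 1 2 - q * (1 - z) * T 3 2 2 1 2 2)%R
  | 5, 3, 0 => (T 1 1 1 2 2 2)%R
  | 5, 2, 1 => (T 1 1 2 1 2 2 - q * T 1 2 2 2 2 2)%R
  | 5, 1, 2 => (T 1 2 2 1 1 2 - q * T 2 2 2 1 2 2)%R
  | 5, 0, 3 => (T 2 2 2 1 1 1 - q * (1 - z) * T 3 2 2 1 1 2)%R
  | 4, 3, 1 => (T 1 1 1 1 2 2 - q * T 1 1 2 2 2 2)%R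
  | 4, 2, 2 => (T 1 1 2 1 1 2 - q * T 1 2 2 1 2 2)%R
  | 4, 1, 3 => (T 1 2 2 1 1 1 - q * T 2 2 2 1 1 2)%R
  | 3, 3, 2 => (T 1 1 1 1 1 2 - q * T 1 1 2 1 2 2)%R
  | 4, 4, 0 => (T 2 1 1 1 2 2 - q * T 2 1 2 2 2 2 + q * z * T 3 2 2 1 1 1)%R
  | _, _, _ => 0%R
  end%N.

(* [rep_sum] is nonzero on at most one rotation of each profile of level 8. *)
Definition profile_sum z T c1 c2 c3 : R :=
  rep_sum z T c1 c2 c3 + rep_sum z T c2 c3 c1 + rep_sum z T c3 c1 c2.

(* The Corteel-Welsh recursion: [Gk c] stands for G_c(z q^k). *)
Definition cw_rhs z (G1 G2 G3 : nat -> nat -> nat -> R) c1 c2 c3 : R :=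
  (if c1 is d1.+1 then G1 d1 c2.+1 c3 else 0)
  + (if c2 is d2.+1 then G1 c1 d2 c3.+1 else 0)
  + (if c3 is d3.+1 then G1 c1.+1 c2 d3 else 0)
  - (1 - z * q) *
    ((if c1 is d1.+1 then if c2 is _.+1 then G2 d1 c2 c3.+1 else 0 else 0)
     + (if c2 is d2.+1 then if c3 is _.+1 then G2 c1.+1 d2 c3 else 0 else 0)
     + (if c3 is d3.+1 then if c1 is _.+1 then G2 c1 c2.+1 d3 else 0 else 0))
  + (1 - z * q) * (1 - z * q ^+ 2) *
    (if c1 is _.+1 then if c2 is _.+1 then if c3 is _.+1 then G3 c1 c2 c3
     else 0 else 0 else 0).

(** The dilation z -> zq acts as z * q together with [shift T], so the defect of the recursion is an
    expression in values of T only. *)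
Definition cw_gap z T c1 c2 c3 : R :=
  profile_sum z T c1 c2 c3
  - cw_rhs z (profile_sum (z * q) (shift T))
             (profile_sum (z * q * q) (shift (shift T)))
             (profile_sum (z * q * q * q) (shift (shift (shift T)))) c1 c2 c3.

Ltac cw_ring :=
  rewrite /cw_gap /cw_rhs /profile_sum /rep_sum /relA1 /relA2 /relA3 /swap
    /shift /=; ring.

Lemma contiguousA1 z T a1 a2 a3 b1 b2 b3 :
  contiguous z T -> relA1 z T a1 a2 a3 b1 b2 b3 = 0.
Proof. by case/(_ a1 a2 a3 b1 b2 b3). Qed.
Lemma contiguousA2 z T a1 a2 a3 b1 b2 b3 :
  contiguous z T -> relA2 z T a1 a2 a3 b1 b2 b3 = 0.
Proof. by case/(_ a1 a2 a3 b1 b2 b3). Qed.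
Lemma contiguousA3 z T a1 a2 a3 b1 b2 b3 :
  contiguous z T -> relA3 z T a1 a2 a3 b1 b2 b3 = 0.
Proof. by case/(_ a1 a2 a3 b1 b2 b3). Qed.

Ltac cw_solve zT :=
  rewrite ?(contiguousA1 _ _ _ _ _ _ (proj1 zT))
    ?(contiguousA2 _ _ _ _ _ _ (proj1 zT))
    ?(contiguousA3 _ _ _ _ _ _ (proj1 zT))
    ?(contiguousA1 _ _ _ _ _ _ (proj2 zT))
    ?(contiguousA2 _ _ _ _ _ _ (proj2 zT))
    ?(contiguousA3 _ _ _ _ _ _ (proj2 zT))
    ?(mulr0, oppr0, addr0, subr0) //.

(** For this profile and the next four the formula in [rep_sum] is exactly what the recursion yields
    from the formulas of the other profiles, so no contiguity relation enters. This is where the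
    coefficients q(1-z) and qz come from. *)
Lemma cw_gap_800 z T : cw_gap z T 8 0 0 = 0.
Proof. by cw_ring. Qed.

Lemma cw_gap_701 z T : cw_gap z T 7 0 1 = 0.
Proof. by cw_ring. Qed.

Lemma cw_gap_602 z T : cw_gap z T 6 0 2 = 0.
Proof. by cw_ring. Qed.

Lemma cw_gap_503 z T : cw_gap z T 5 0 3 = 0.
Proof. by cw_ring. Qed.

Lemma cw_gap_440 z T : cw_gap z T 4 4 0 = 0.
Proof. by cw_ring. Qed.

(* The coefficients of the linear combinations below solve a linear system over
   Q(z, q); the recursions proved first, dilated, serve as auxiliary relations. *)
Lemma cw_gap_710 z T : bicontiguous z T -> cw_gap z T 7 1 0 = 0.
Proof.
move=> zT.
have -> : cw_gap z T 7 1 0 =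
      relA1 z T 1 1 2 1 2 2.
  by cw_ring.
cw_solve zT.
Qed.

Lemma cw_gap_620 z T : bicontiguous z T -> cw_gap z T 6 2 0 = 0.
Proof.
move=> zT.
have -> : cw_gap z T 6 2 0 =
      relA1 z T 1 1 1 1 2 2
    - relA1 z T 2 1 2 0 2 2
    + z * q ^+ 2 * relA1 z T 3 2 2 0 1 2
    + relA2 z T 1 1 1 1 1 2
    - z * q * relA2 z T 3 1 1 0 1 2
    - z * q ^+ 2 * relA1 1 (swap T) 0 1 2 3 2 2.
  by cw_ring.
cw_solve zT.
Qed.

Lemma cw_gap_611 z T : bicontiguous z T -> cw_gap z T 6 1 1 = 0.
Proof.
move=> zT.
have -> : cw_gap z T 6 1 1 =
      relA1 z T 1 1 2 0 2 2
    - (1 - z * q) * relA1 z T 2 1 2 1 2 2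
    + z * q * relA1 1 (swap T) 0 1 2 2 2 2.
  by cw_ring.
cw_solve zT.
Qed.

Lemma cw_gap_530 z T : bicontiguous z T -> cw_gap z T 5 3 0 = 0.
Proof.
move=> zT.
have -> : cw_gap z T 5 3 0 =
      relA1 z T 1 0 1 1 2 2
    - q * relA1 z T 1 0 2 2 2 2
    + relA2 z T 2 0 1 1 1 1
    - q * relA2 z T 2 0 2 1 1 2
    - q * relA2 z T 2 1 2 1 1 2
    + relA3 z T 2 0 1 1 1 1
    + relA3 z T 2 1 1 1 1 1
    + q * relA1 1 (swap T) 2 2 2 1 0 2
    - relA1 1 (swap T) 1 1 2 1 1 2
    - relA2 1 (swap T) 2 1 1 1 0 2
    + relA2 1 (swap T) 0 0 0 2 0 1
    - relA2 1 (swap T) 0 0 1 2 0 1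
    - q * relA2 1 (swap T) 0 0 1 2 0 2
    + q * relA2 1 (swap T) 0 0 2 2 0 2
    - relA3 1 (swap T) 0 0 1 2 0 1
    + relA3 1 (swap T) 0 1 0 2 0 1.
  by cw_ring.
cw_solve zT.
Qed.

Lemma cw_gap_521 z T : bicontiguous z T -> cw_gap z T 5 2 1 = 0.
Proof.
move=> zT.
have -> : cw_gap z T 5 2 1 =
      relA1 z T 1 0 2 0 2 2
    - q * relA1 z T 1 1 2 1 2 2
    - (1 - z * q) * relA1 z T 2 0 2 1 2 2
    - relA1 z T 2 1 2 0 1 2
    + (1 - z * q) * relA1 z T 3 1 2 0 2 2
    + relA2 z T 2 0 1 0 1 2
    - (1 - z * q) * relA2 z T 3 0 1 1 1 2
    + z * q * relA1 1 (swap T) 0 1 2 2 1 2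
    + (z * q ^+ 3 - z ^+ 2 * q ^+ 4) * relA1 1 (swap T) 0 1 2 4 2 2.
  by cw_ring.
cw_solve zT.
Qed.

Lemma cw_gap_512 z T : bicontiguous z T -> cw_gap z T 5 1 2 = 0.
Proof.
move=> zT.
have -> : cw_gap z T 5 1 2 =
      relA1 z T 1 1 2 0 1 2
    - relA1 z T 2 1 2 0 2 2
    + z * q * relA1 z T 2 1 2 1 1 2
    - z * q * relA1 1 (swap T) 1 1 2 2 1 2
    + z * q * relA1 1 (swap T) 0 0 2 2 2 2
    - z * q ^+ 2 * relA1 1 (swap T) 0 1 2 3 2 2
    + z * q * relA2 1 (swap T) 1 0 1 2 1 2.
  by cw_ring.
cw_solve zT.
Qed.

Lemma cw_gap_422 z T : bicontiguous z T -> cw_gap z T 4 2 2 = 0.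
Proof.
move=> zT.
have -> : cw_gap z T 4 2 2 =
      relA1 z T 1 0 2 0 1 2
    - (1 - z * q) * relA1 z T 2 0 2 1 1 2
    - relA1 z T 2 1 2 0 0 2
    + (1 - z * q) * relA1 z T 3 1 2 0 1 2
    + relA2 z T 2 0 1 0 0 2
    - (1 - z * q) * relA2 z T 3 0 1 0 1 2
    - (q - z * q ^+ 2) * relA2 z T 3 1 2 0 0 2
    + (1 - z * q) * relA3 z T 3 1 1 0 0 1
    - relA1 1 (swap T) 1 1 2 1 1 2
    + (1 - z * q) * relA1 1 (swap T) 1 1 2 2 0 2
    + z * q * relA1 1 (swap T) 0 0 2 2 1 2
    + relA2 1 (swap T) 1 0 1 1 1 2
    - (1 - z * q) * relA2 1 (swap T) 1 0 1 2 0 2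
    + (q - z * q ^+ 2) * relA2 1 (swap T) 1 1 2 2 0 2
    - (1 - z * q) * relA3 1 (swap T) 1 1 1 2 0 1
    - q * cw_gap z T 6 1 1.
  by cw_ring.
rewrite (cw_gap_611 zT).
cw_solve zT.
Qed.

Lemma cw_gap_413 z T : bicontiguous z T -> cw_gap z T 4 1 3 = 0.
Proof.
move=> zT.
have -> : cw_gap z T 4 1 3 =
      relA1 z T 1 1 1 0 1 2
    + q * relA1 z T 1 2 2 0 1 2
    - relA1 z T 2 1 2 0 1 2
    + z * q * relA1 z T 2 1 2 1 1 1
    + z * q ^+ 2 * relA1 z T 3 2 2 0 0 2
    + q * relA2 z T 1 2 2 0 0 2
    - z * q ^+ 2 * relA2 z T 2 2 2 1 0 2
    - z * q * relA2 z T 3 1 1 0 0 2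
    + z * q ^+ 2 * relA2 z T 3 1 2 1 0 2
    - relA3 z T 1 2 1 0 0 1
    + z * q * relA3 z T 2 2 1 1 0 1
    - z * q * relA3 z T 3 1 1 1 0 1
    - z * q * relA1 1 (swap T) 1 1 2 2 1 1
    + z * q * relA1 1 (swap T) 0 0 2 2 2 1
    + z * q ^+ 2 * relA1 1 (swap T) 0 0 2 2 3 2
    - z * q ^+ 2 * relA1 1 (swap T) 0 0 2 3 2 2
    - q * relA2 1 (swap T) 1 1 2 0 1 2
    + z * q ^+ 2 * relA2 1 (swap T) 2 1 2 1 1 2
    - z * q ^+ 2 * relA2 1 (swap T) 2 1 2 2 0 2
    + z * q * relA2 1 (swap T) 1 0 1 2 1 1
    - z * q ^+ 2 * relA2 1 (swap T) 1 1 2 2 1 2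
    + relA3 1 (swap T) 1 1 1 0 1 1
    - z * q * relA3 1 (swap T) 2 1 1 1 1 1
    + z * q * relA3 1 (swap T) 2 1 1 2 0 1
    + z * q * relA3 1 (swap T) 1 1 1 2 1 1
    - q * cw_gap z T 6 1 1
    - (q - z * q ^+ 2) * cw_gap (z * q ^+ 1) (iter 1 shift T) 7 1 0.
  by cw_ring.
rewrite (cw_gap_611 zT).
rewrite (@cw_gap_710 _ _ (bicontiguous_iter 1 zT)).
cw_solve zT.
Qed.

Lemma cw_gap_431 z T : bicontiguous z T -> cw_gap z T 4 3 1 = 0.
Proof.
move=> zT.
have -> : cw_gap z T 4 3 1 =
      q * relA1 z T 0 0 1 2 2 2
    + relA1 z T 1 0 2 1 1 1
    - q * relA1 z T 1 1 2 1 1 2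
    - relA1 z T 2 1 2 0 1 1
    - q ^+ 2 * relA2 z T 1 0 2 2 1 2
    - q * relA2 z T 1 1 2 1 0 2
    + relA2 z T 2 0 1 0 1 1
    - q * relA2 z T 2 1 2 0 1 2
    - (q - z * q ^+ 2) * relA2 z T 3 1 2 0 0 2
    + q * relA3 z T 1 0 1 2 1 1
    + relA3 z T 1 1 1 1 0 1
    + relA3 z T 2 1 1 0 1 1
    + (1 - z * q) * relA3 z T 3 1 1 0 0 1
    + relA1 1 (swap T) 1 1 2 0 1 1
    - relA1 1 (swap T) 1 1 1 1 0 2
    + q * relA1 1 (swap T) 1 1 2 1 1 2
    + q * relA2 1 (swap T) 2 1 2 0 0 2
    + relA2 1 (swap T) 1 0 0 1 0 1
    - relA2 1 (swap T) 1 0 1 1 0 1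
    - q * relA2 1 (swap T) 1 0 1 1 0 2
    + q * relA2 1 (swap T) 1 0 2 1 0 2
    - relA2 1 (swap T) 1 1 1 1 0 2
    + (q - z * q ^+ 2) * relA2 1 (swap T) 1 1 2 2 0 2
    - relA3 1 (swap T) 2 1 1 0 0 1
    - relA3 1 (swap T) 1 0 1 1 0 1
    + relA3 1 (swap T) 1 1 0 1 0 1
    - (1 - z * q) * relA3 1 (swap T) 1 1 1 2 0 1
    - (1 - z * q) * cw_gap (z * q ^+ 1) (iter 1 shift T) 5 3 0.
  by cw_ring.
rewrite (@cw_gap_530 _ _ (bicontiguous_iter 1 zT)).
cw_solve zT.
Qed.

Lemma cw_gap_332 z T : bicontiguous z T -> cw_gap z T 3 3 2 = 0.
Proof.
move=> zT.
have -> : cw_gap z T 3 3 2 =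
      relA1 z T 1 0 1 0 1 2
    - z * q ^+ 2 * relA1 z T 1 0 1 2 2 2
    - relA1 z T 2 1 1 0 1 1
    + relA2 z T 2 0 0 0 0 2
    - relA2 z T 2 1 1 0 0 2
    + relA3 z T 2 1 0 0 0 1
    - z * q * relA1 1 (swap T) 1 1 2 1 1 1
    + z * q * relA1 1 (swap T) 0 0 2 2 1 1
    + q * relA2 1 (swap T) 1 1 2 1 0 1
    - q * relA2 1 (swap T) 1 1 2 1 0 2
    - q * relA2 1 (swap T) 1 1 2 1 1 2
    + z * q * relA2 1 (swap T) 1 0 1 2 0 1
    + (q - z * q ^+ 2) * relA2 1 (swap T) 1 1 2 2 0 2
    + z * q ^+ 2 * relA2 1 (swap T) 0 0 1 3 1 1
    - relA3 1 (swap T) 1 1 1 1 0 0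
    + relA3 1 (swap T) 1 1 1 1 0 1
    + relA3 1 (swap T) 1 1 1 1 1 1
    - (1 - z * q) * relA3 1 (swap T) 1 1 1 2 0 1
    - (1 - z * q) * cw_gap (z * q ^+ 1) (iter 1 shift T) 4 3 1
    - q * cw_gap z T 5 2 1
    - (1 - z * q - z * q ^+ 2 + z ^+ 2 * q ^+ 3) *
      cw_gap (z * q ^+ 2) (iter 2 shift T) 5 3 0
    - (q - z * q ^+ 2) * cw_gap (z * q ^+ 1) (iter 1 shift T) 6 2 0
    - q ^+ 2 * cw_gap z T 7 1 0.
  by cw_ring.
rewrite (@cw_gap_431 _ _ (bicontiguous_iter 1 zT)).
rewrite (cw_gap_521 zT).
rewrite (@cw_gap_530 _ _ (bicontiguous_iter 2 zT)).
rewrite (@cw_gap_620 _ _ (bicontiguous_iter 1 zT)).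
rewrite (cw_gap_710 zT).
cw_solve zT.
Qed.

(** Reduces the 45 profiles of level 8 to the fifteen treated above. *)
Lemma cw_gap_rot z T c1 c2 c3 : cw_gap z T c1 c2 c3 = cw_gap z T c2 c3 c1.
Proof.
rewrite /cw_gap /cw_rhs /profile_sum.
by case: c1 => [|c1]; case: c2 => [|c2]; case: c3 => [|c3]; ring.
Qed.

Ltac cw_rep zT :=
  match goal with
  | |- cw_gap _ _ 8 0 0 = 0 => exact: cw_gap_800
  | |- cw_gap _ _ 7 0 1 = 0 => exact: cw_gap_701
  | |- cw_gap _ _ 6 0 2 = 0 => exact: cw_gap_602
  | |- cw_gap _ _ 5 0 3 = 0 => exact: cw_gap_503
  | |- cw_gap _ _ 4 4 0 = 0 => exact: cw_gap_440
  | |- cw_gap _ _ 7 1 0 = 0 => exact: cw_gap_710 zT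
  | |- cw_gap _ _ 6 2 0 = 0 => exact: cw_gap_620 zT
  | |- cw_gap _ _ 6 1 1 = 0 => exact: cw_gap_611 zT
  | |- cw_gap _ _ 5 3 0 = 0 => exact: cw_gap_530 zT
  | |- cw_gap _ _ 5 2 1 = 0 => exact: cw_gap_521 zT
  | |- cw_gap _ _ 5 1 2 = 0 => exact: cw_gap_512 zT
  | |- cw_gap _ _ 4 2 2 = 0 => exact: cw_gap_422 zT
  | |- cw_gap _ _ 4 1 3 = 0 => exact: cw_gap_413 zT
  | |- cw_gap _ _ 4 3 1 = 0 => exact: cw_gap_431 zT
  | |- cw_gap _ _ 3 3 2 = 0 => exact: cw_gap_332 zT
  end.

Lemma cw_gap_eq0 z T c1 c2 c3 :
  bicontiguous z T -> (c1 + c2 + c3 = 8)%N -> cw_gap z T c1 c2 c3 = 0.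
Proof.
(* Written with [Nat.sub], c3 becomes a numeral under [cbn]; the cases with c1 + c2 > 8 contradict
   the hypothesis on the level. *)
move=> zT e; have c3E : c3 = Nat.sub 8 (Nat.add c1 c2) by lia.
move: c3 c3E e => _ ->.
case: c1 => [|[|[|[|[|[|[|[|[|c1]]]]]]]]];
case: c2 => [|[|[|[|[|[|[|[|[|c2]]]]]]]]]; cbn [Nat.sub Nat.add];
  first [by move=> /eqP|move=> _];
  first [cw_rep zT|rewrite cw_gap_rot; cw_rep zT
        |rewrite cw_gap_rot cw_gap_rot; cw_rep zT].
Qed.

Lemma profile_sum_rep z T c1 c2 c3 :
  rep_sum z T c2 c3 c1 = 0 -> rep_sum z T c3 c1 c2 = 0 ->
  profile_sum z T c1 c2 c3 = rep_sum z T c1 c2 c3.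
Proof. by rewrite /profile_sum => -> ->; rewrite !addr0. Qed.

(** Used with k = q^3: the difference of two solutions of the recursion is again a solution. *)
Lemma cw_rhs_linear z k G1 G2 G3 G1' G2' G3' c1 c2 c3 :
  cw_rhs z (fun a b c => k * G1 a b c - G1' a b c)
    (fun a b c => k * G2 a b c - G2' a b c)
    (fun a b c => k * G3 a b c - G3' a b c) c1 c2 c3 =
  k * cw_rhs z G1 G2 G3 c1 c2 c3 - cw_rhs z G1' G2' G3' c1 c2 c3.
Proof.
by rewrite /cw_rhs; case: c1 => [|?]; case: c2 => [|?]; case: c3 => [|?]; ring.
Qed.

(** Here phi is the specialization z = 0, after which T depends on the second triple of shifts only.
    Each right-hand side then becomes V 1 1 1 or one of the three differences in the hypotheses. *)
Lemma rmorph_profile_sum (phi : {rmorphism R -> R}) z T V c1 c2 c3 :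
  phi q = q -> phi z = 0 ->
  (forall a1 a2 a3 b1 b2 b3, phi (T a1 a2 a3 b1.+1 b2.+1 b3.+1) = V b1 b2 b3) ->
  V 0 1 1 - q * V 1 1 1 = V 1 1 1 -> V 0 0 1 - q * V 0 1 1 = V 1 1 1 ->
  V 0 0 0 - q * V 0 0 1 = V 1 1 1 ->
  (c1 + c2 + c3 = 8)%N -> phi (profile_sum z T c1 c2 c3) = V 1 1 1.
Proof.
move=> phiq phiz phiT v1 v2 v3 e.
have c3E : c3 = Nat.sub 8 (Nat.add c1 c2) by lia.
move: c3 c3E e => _ ->.
case: c1 => [|[|[|[|[|[|[|[|[|c1]]]]]]]]];
case: c2 => [|[|[|[|[|[|[|[|[|c2]]]]]]]]]; cbn [Nat.sub Nat.add];
  first [by move=> /eqP|move=> _];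
  rewrite /profile_sum /rep_sum ?(addr0, add0r);
  rewrite ?(rmorphD, rmorphN, rmorphM, rmorph1) ?(phiT, phiq, phiz);
  rewrite ?(oppr0, addr0, mulr1, mulr0, mul0r) //.
Qed.

End Contiguity.

(** * Summable families of series *)

Lemma fpsE (R : Type) (a b : fps R) : (forall i, a i = b i) -> a = b.
Proof. by move=> ab; apply/fpsP. Qed.

Lemma fps_coefD (R : zmodType) (a b : fps R) i : (a + b) i = a i + b i.
Proof. by []. Qed.
Lemma fps_coefN (R : zmodType) (a : fps R) i : (- a) i = - a i.
Proof. by []. Qed.
Lemma fps_coefM (R : comNzRingType) (a b : fps R) n :
  (a * b) n = \sum_(i < n.+1) a i * b (n - i)%N.
Proof. by []. Qed.
Lemma fps_coef_sum (R : zmodType) (I : Type) (r : seq I) (f : I -> fps R) i :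
  (\sum_(x <- r) f x) i = \sum_(x <- r) f x i.
Proof. by elim: r => [|x r IH]; rewrite ?big_nil // !big_cons fps_coefD IH. Qed.

(** Congruence modulo the ideal generated by z^(N+1) and q^(N+1). Infinite sums and limits are
    handled by replacing them, modulo each of these ideals, with finite expressions. *)
Definition eqm (N : nat) (a b : series) :=
  forall i j, (i <= N)%N -> (j <= N)%N -> a i j = b i j.

Lemma eqm_all a b : (forall N, eqm N a b) -> a = b.
Proof.
move=> ab; apply: fpsE => i; apply: fpsE => j.
by apply: (ab (maxn i j)); rewrite (leq_maxl, leq_maxr).
Qed.

Lemma eqm_sym N a b : eqm N a b -> eqm N b a.
Proof. by move=> ab i j iN jN; rewrite ab. Qed.
Lemma eqm_trans N b a c : eqm N a b -> eqm N b c -> eqm N a c.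
Proof. by move=> ab bc i j iN jN; rewrite ab // bc. Qed.
Lemma eqmD N a a' b b' : eqm N a a' -> eqm N b b' -> eqm N (a + b) (a' + b').
Proof. by move=> aa bb i j iN jN; rewrite !fps_coefD aa // bb. Qed.
Lemma eqmN N a a' : eqm N a a' -> eqm N (- a) (- a').
Proof. by move=> aa i j iN jN; rewrite !fps_coefN aa. Qed.

Lemma eqmM N a a' b b' : eqm N a a' -> eqm N b b' -> eqm N (a * b) (a' * b').
Proof.
move=> aa bb i j iN jN; rewrite !fps_coefM !fps_coef_sum.
apply: eq_bigr => k _; rewrite !fps_coefM; apply: eq_bigr => l _.
have := ltn_ord k; have := ltn_ord l => ? ?.
by rewrite aa ?bb //; lia.
Qed.
Lemma eqm_sum N (I : eqType) (r : seq I) (f g : I -> series) :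
  {in r, forall x, eqm N (f x) (g x)} ->
  eqm N (\sum_(x <- r) f x) (\sum_(x <- r) g x).
Proof.
elim: r => [|x r IH] fg; rewrite ?big_nil // !big_cons.
apply: eqmD; first by apply: fg; rewrite mem_head.
by apply: IH => y yr; apply: fg; rewrite inE yr orbT.
Qed.

(** The terms tend to 0 along the cofinite sets, in the adic topology given by [eqm]. *)
Definition summable (T : eqType) (f : T -> series) :=
  forall N, exists D : seq T, forall x, x \notin D -> eqm N (f x) 0.

Notation ssum f := (series_sum [set: _] f).

Section Sums.
Variable T : choiceType.
Implicit Types (f g : T -> series) (A : set T) (D : seq T).


Lemma series_sum_mkcond A f :
  series_sum A f = ssum (fun x => if x \in A then f x else 0).
Proof.
apply: fpsE => i; apply: fpsE => j /=; rewrite fsbig_mkcond.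
by apply: eq_fsbigr => x _; rewrite /patch; case: ifP.
Qed.

Lemma eq_ssum f g : f =1 g -> ssum f = ssum g.
Proof. by move=> /funext ->. Qed.

Lemma ssum_eqm N f D : uniq D -> (forall x, x \notin D -> eqm N (f x) 0) ->
  eqm N (ssum f) (\sum_(x <- D) f x).
Proof.
move=> uD fD i j iN jN; rewrite !fps_coef_sum /=.
rewrite (fsbigE D) //; last by move=> x _ /fD ->.
by apply: eq_bigl => x; rewrite in_setT.
Qed.

Lemma summable_uniq N f : summable f ->
  exists2 D : seq T, uniq D & forall x, x \notin D -> eqm N (f x) 0.
Proof.
move=> /(_ N)[D fD]; exists (undup D); first exact: undup_uniq.
by move=> x; rewrite mem_undup; exact: fD.
Qed.

Lemma summable_uniq2 N f g : summable f -> summable g ->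
  exists2 D : seq T, uniq D
  & forall x, x \notin D -> eqm N (f x) 0 /\ eqm N (g x) 0.
Proof.
move=> /(_ N)[D fD] /(_ N)[E gE]; exists (undup (D ++ E)).
  exact: undup_uniq.
move=> x; rewrite mem_undup mem_cat negb_or => /andP[xD xE].
by split; [exact: fD|exact: gE].
Qed.

Lemma summable_sub f g :
  (forall N x, eqm N (f x) 0 -> eqm N (g x) 0) -> summable f -> summable g.
Proof. by move=> fg sf N; have [D fD] := sf N; exists D => x /fD /fg. Qed.

Lemma eqm_mul0 N a b : eqm N b 0 -> eqm N (a * b) 0.
Proof. by move=> b0; rewrite -(mulr0 a); apply: eqmM. Qed.

Lemma summableM c f : summable f -> summable (fun x => c * f x).
Proof. by apply: summable_sub => N x; exact: eqm_mul0. Qed.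

Lemma summableD f g : summable f -> summable g -> summable (fun x => f x + g x).
Proof.
move=> sf sg N; have [D _ fgD] := summable_uniq2 N sf sg; exists D => x.
by move=> /fgD[fx gx]; rewrite -[X in eqm N _ X](addr0 0); exact: eqmD.
Qed.

Lemma ssumM c f : summable f -> ssum (fun x => c * f x) = c * ssum f.
Proof.
move=> sf; apply: eqm_all => N; have [D uD fD] := summable_uniq N sf.
have cfD x : x \notin D -> eqm N (c * f x) 0 by move=> /fD; exact: eqm_mul0.
apply: eqm_trans (ssum_eqm uD cfD) _; rewrite -mulr_sumr.
by apply: eqmM => //; apply: eqm_sym; exact: ssum_eqm.
Qed.

Lemma ssumD f g : summable f -> summable g ->
  ssum (fun x => f x + g x) = ssum f + ssum g.
Proof.
move=> sf sg; apply: eqm_all => N; have [D uD fgD] := summable_uniq2 N sf sg.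
apply: (@eqm_trans _ (\sum_(x <- D) (f x + g x))).
  apply: ssum_eqm => // x /fgD[fx gx].
  by rewrite -[X in eqm N _ X](addr0 0); exact: eqmD.
rewrite big_split /=; apply: eqm_sym.
by apply: eqmD; apply: ssum_eqm => // x /fgD[].
Qed.

Lemma summableN f : summable f -> summable (fun x => - f x).
Proof.
by apply: summable_sub => N x; rewrite -[in X in _ -> X]oppr0; exact: eqmN.
Qed.

Lemma ssumN f : summable f -> ssum (fun x => - f x) = - ssum f.
Proof.
move=> sf; rewrite -mulN1r -ssumM //; apply: eq_ssum => x.
by rewrite mulN1r.
Qed.

Lemma ssumB f g : summable f -> summable g ->
  ssum (fun x => f x - g x) = ssum f - ssum g.
Proof. by move=> sf sg; rewrite ssumD ?ssumN //; exact: summableN. Qed.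

Lemma ssum0 : ssum (fun _ : T => 0) = 0.
Proof.
apply: eqm_all => N; have := @ssum_eqm N (fun=> 0) [::] isT.
by rewrite big_nil; apply.
Qed.

Lemma ssum1 x0 f : (forall x, x != x0 -> f x = 0) -> ssum f = f x0.
Proof.
move=> fx0; apply: eqm_all => N; have := @ssum_eqm N f [:: x0] isT.
by rewrite big_seq1; apply=> x; rewrite inE => /fx0 ->.
Qed.

End Sums.

(** The preimage of a finite list under an injection is finite; it is built element by element,
    deciding classically whether a preimage exists. *)
Lemma summable_inj (T T' : eqType) (h : T' -> T) (f : T -> series) :
  injective h -> summable f -> summable (f \o h).
Proof.
move=> hI sf N; have [D fD] := sf N.
suff [D' D'P] : exists D' : seq T', forall x, h x \in D -> x \in D'.
  by exists D' => x xD'; apply: fD; apply: contra xD'; exact: D'P.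
elim: D {fD} => [|y D [D' D'P]]; first by exists [::].
have [[x hx]|nhx] := pselect (exists x, h x = y).
  exists (x :: D') => x'; rewrite !inE -hx (inj_eq hI).
  by case/orP=> [->//|/D'P ->]; rewrite orbT.
exists D' => x; rewrite inE => /orP[/eqP hx|/D'P //].
by case: nhx; exists x.
Qed.

(* [ssum] of a non-summable family is a junk value, so summability of one side
   is needed. *)
Lemma ssum_reindex (T T' : choiceType) (h : T' -> T) (f : T -> series) :
  injective h -> (forall x, (forall y, h y <> x) -> f x = 0) ->
  summable (f \o h) -> summable f /\ ssum f = ssum (f \o h).
Proof.
move=> hI f0 sfh.
have cover N (D : seq T') : (forall y, y \notin D -> eqm N (f (h y)) 0) ->
    forall x, x \notin map h D -> eqm N (f x) 0.
  move=> fhD x xD; have [[y hy]|nhy] := pselect (exists y, h y = x).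
    by rewrite -hy; apply: fhD; apply: contra xD => yD; rewrite -hy map_f.
  by rewrite f0 // => y hy; apply: nhy; exists y.
split=> [N|]; first by have [D /cover fD] := sfh N; exists (map h D).
apply: eqm_all => N; have [D uD fD] := summable_uniq N sfh.
apply: eqm_trans (ssum_eqm _ (cover _ _ fD)) _; first by rewrite map_inj_uniq.
by rewrite big_map; apply: eqm_sym; exact: ssum_eqm.
Qed.

(** Regrouping the pairs (k, l) by k + l isolates a finite inner sum, to which the convolution
    [ipoch_conv] can be applied. *)
Lemma ssum_antidiag (T : choiceType) (f : T * nat * nat -> series) :
  summable f ->
  summable (fun x => \sum_(l < x.2.+1) f (x.1, (x.2 - l)%N, nat_of_ord l)) /\
  ssum f = ssum (fun x => \sum_(l < x.2.+1) f (x.1, (x.2 - l)%N, nat_of_ord l)).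
Proof.
set g := fun x : T * nat => _; move=> sf.
pose fib (x : T * nat) := [seq (x.1, (x.2 - l)%N, l) | l <- iota 0 x.2.+1].
have gE x : g x = \sum_(y <- fib x) f y.
  by rewrite /g big_map -[iota _ _]/(index_iota 0 x.2.+1) big_mkord.
have fibP x y : (y \in fib x) = ((y.1.1, (y.1.2 + y.2)%N) == x).
  case: x => x n; case: y => [[y k] l]; apply/mapP/eqP => [[l']|[-> <-]].
    by rewrite mem_iota add0n ltnS => l'n [-> -> ->] /=; rewrite subnK.
  exists l; first by rewrite mem_iota add0n ltnS leq_addl.
  by rewrite addnK.
have ufib x : uniq (fib x) by rewrite map_inj_uniq ?iota_uniq // => l l' [].
(* Forgets the body of [fib]; the rest relies on these three properties. *)
move: fib gE fibP ufib => fib gE fibP ufib.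
have cover N (D : seq (T * nat * nat)) :
    (forall y, y \notin D -> eqm N (f y) 0) ->
  exists2 E : seq (T * nat), uniq E & {subset D <= flatten (map fib E)}.
  move=> fD; exists (undup [seq (y.1.1, (y.1.2 + y.2)%N) | y <- D]).
    exact: undup_uniq.
  move=> y yD; apply/flatten_mapP; exists (y.1.1, (y.1.2 + y.2)%N).
    by rewrite mem_undup; apply: map_f.
  by rewrite fibP.
have gE0 N E : (forall y, y \notin flatten (map fib E) -> eqm N (f y) 0) ->
    forall x, x \notin E -> eqm N (g x) 0.
  move=> fE x xE; rewrite gE.
  apply: (@eqm_trans _ (\sum_(y <- fib x) 0)); last by rewrite big1.
  apply: eqm_sum => y; rewrite fibP => /eqP yx; apply: fE.
  by apply/flatten_mapP => -[x' x'E]; rewrite fibP yx => /eqP xx';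
    rewrite xx' x'E in xE.
split=> [N|]; [|apply: eqm_all => N];
    have [D uD fD] := summable_uniq N sf; have [E uE DE] := cover N D fD;
    have fE y : y \notin flatten (map fib E) -> eqm N (f y) 0
      by move=> yE; apply: fD; apply: contra yE; exact: DE.
  by exists E; exact: gE0.
apply: (@eqm_trans _ (\sum_(y <- flatten (map fib E)) f y)).
  apply: ssum_eqm => //; elim: E uE {DE fE} => //= x E IH /andP[xE /IH uE].
  rewrite cat_uniq ufib uE andbT.
  apply/hasPn => y /flatten_mapP[x' x'E]; rewrite !fibP => /eqP ->.
  by apply: contra xE => /eqP <-.
rewrite big_flatten big_map /=; apply: eqm_sym.
have -> : \sum_(x <- E) \sum_(y <- fib x) f y = \sum_(x <- E) g x.
  by apply: eq_bigr => x _; rewrite gE.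
by apply: ssum_eqm => // x; exact: gE0.
Qed.

(** * Dilation, specialization at z = 0, and q-factorials *)

Lemma fpsC_coefM (R : comNzRingType) (c : R) (a : fps R) i :
  (fpsC c * a) i = c * a i.
Proof.
rewrite fps_coefM big_ord_recl /= subn0 big1 ?addr0 // => j _.
by rewrite mul0r.
Qed.

Lemma fpsX_coefM (R : comNzRingType) (a : fps R) i :
  (fpsX R * a) i = if i is j.+1 then a j else 0.
Proof.
case: i => [|i]; first by rewrite fps_coefM big_ord1 /= mul0r.
rewrite fps_coefM 2!big_ord_recl /= mul0r add0r mul1r big1 ?addr0.
  by rewrite /bump /= subn1.
by move=> j _; rewrite mul0r.
Qed.

Lemma fpsXn_coefM (R : comNzRingType) (a : fps R) n i :
  (fpsX R ^+ n * a) i = if (n <= i)%N then a (i - n)%N else 0.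
Proof.
elim: n i => [|n IH] i; first by rewrite mul1r subn0.
by rewrite exprS -mulrA fpsX_coefM; case: i => // i; rewrite IH.
Qed.

Lemma qXn_coefM (a : series) n i : (q ^+ n * a) i = fpsX int ^+ n * a i.
Proof.
elim: n => [|n IH]; first by rewrite !mul1r.
by rewrite !exprS -!mulrA /q fpsC_coefM IH.
Qed.

Lemma eqm_qXn N n a : (N < n)%N -> eqm N (q ^+ n * a) 0.
Proof.
by move=> Nn i j iN jN; rewrite qXn_coefM fpsXn_coefM leqNgt (leq_ltn_trans jN).
Qed.

Lemma eqm_zXn N n a : (N < n)%N -> eqm N (z ^+ n * a) 0.
Proof.
by move=> Nn i j iN jN; rewrite fpsXn_coefM leqNgt (leq_ltn_trans iN).
Qed.

Lemma mulq_inj (a b : series) : q * a = q * b -> a = b.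
Proof.
move=> /fpsP ab; apply: fpsE => i; apply: fpsE => j.
by have /fpsP/(_ j.+1) := ab i; rewrite /q !fpsC_coefM !fpsX_coefM.
Qed.

(** The substitution z -> zq. *)
Definition dil (a : series) : series := Fps (fun i => fpsX int ^+ i * a i).

Fact dil_is_additive : zmod_morphism dil.
Proof. by move=> a b; apply: fpsE => i /=; rewrite mulrBr. Qed.
Fact dil_is_multiplicative : monoid_morphism dil.
Proof.
split=> [|a b]; apply: fpsE => i.
  by case: i => [|i] /=; rewrite ?mul1r ?mulr0.
rewrite /= /fps_mul /= [LHS]mulr_sumr; apply: eq_bigr => j _ /=.
rewrite mulrACA -exprD subnKC //; have := ltn_ord j; lia.
Qed.
HB.instance Definition _ :=
  GRing.isZmodMorphism.Build series series dil dil_is_additive.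
HB.instance Definition _ :=
  GRing.isMonoidMorphism.Build series series dil dil_is_multiplicative.

Lemma dil_q : dil q = q.
Proof. by apply: fpsE => -[|i] /=; rewrite ?mul1r ?mulr0. Qed.

Lemma dil_z : dil z = z * q.
Proof.
rewrite mulrC; apply: fpsE => i; rewrite /q fpsC_coefM /=.
by case: i => [|[|i]] /=; rewrite ?mulr0 ?expr1.
Qed.

Lemma eqm_dil N a b : eqm N a b -> eqm N (dil a) (dil b).
Proof.
move=> ab i j iN jN; rewrite !fpsXn_coefM; case: ifP => // ij.
by apply: ab => //; lia.
Qed.

Section ContinuousAdditive.
Variable phi : {additive series -> series}.
Hypothesis phi_eqm : forall N a b, eqm N a b -> eqm N (phi a) (phi b).
Variables (T : choiceType) (f : T -> series).
Hypothesis sf : summable f.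

Lemma summable_additive : summable (fun x => phi (f x)).
Proof.
move=> N; have [D fD] := sf N; exists D => x /fD fx.
by rewrite -(raddf0 phi); exact: phi_eqm.
Qed.

(** Modulo each [eqm] the sum is finite, and phi respects these congruences. Applied to [at_z0],
    [dil] and the iterates of [dil]. *)
Lemma additive_ssum : phi (ssum f) = ssum (fun x => phi (f x)).
Proof.
apply: eqm_all => N; have [D uD fD] := summable_uniq N sf.
apply: (@eqm_trans _ (\sum_(x <- D) phi (f x))).
  by rewrite -raddf_sum; apply: phi_eqm; exact: ssum_eqm.
apply: eqm_sym; apply: ssum_eqm => // x /fD fx.
by rewrite -(raddf0 phi); exact: phi_eqm.
Qed.

End ContinuousAdditive.

Lemma unit_1Bq n : 1 - q ^+ n.+1 \is a GRing.unit.
Proof.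
rewrite !fps_unitE -[q ^+ _]mulr1.
rewrite (_ : (1 - _ : series) 0%N 0%N = 1) ?unitr1 //.
by rewrite !fps_coefD !fps_coefN qXn_coefM fpsXn_coefM /= oppr0 addr0.
Qed.

Lemma qpoch_unit n : qpoch q n \is a GRing.unit.
Proof.
rewrite /qpoch; elim/big_rec: _ => [|i a _ ua]; first exact: unitr1.
by rewrite -exprS unitrM unit_1Bq.
Qed.

(* Locked: otherwise failing unifications unfold the quotient. *)
HB.lock Definition ipoch n : series := (qpoch q n)^-1.
Lemma ipochE n : ipoch n = (qpoch q n)^-1. Proof. by rewrite ipoch.unlock. Qed.

Lemma ipoch0 : ipoch 0 = 1.
Proof. by rewrite ipochE /qpoch big_ord0 invr1. Qed.

Lemma ipochS n : (1 - q ^+ n.+1) * ipoch n.+1 = ipoch n.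
Proof.
rewrite !ipochE [in LHS]/qpoch big_ord_recr /= -exprS invrM ?unit_1Bq //.
  by rewrite mulVKr ?unit_1Bq.
exact: qpoch_unit.
Qed.

Lemma rmorph_ipoch (phi : {rmorphism series -> series}) n :
  phi q = q -> phi (ipoch n) = ipoch n.
Proof.
move=> phiq; rewrite ipochE rmorphV ?qpoch_unit // /qpoch rmorph_prod.
congr _^-1; apply: eq_bigr => i _.
by rewrite rmorphB rmorph1 rmorphM rmorphXn phiq.
Qed.

Lemma dil_ipoch n : dil (ipoch n) = ipoch n.
Proof. exact: rmorph_ipoch dil_q. Qed.

Definition at_z0 (a : series) : series := fpsC (a 0%N).

Fact at_z0_is_additive : zmod_morphism at_z0.
Proof. by move=> a b; apply: fpsE => -[|i] //=; rewrite subr0. Qed.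
Fact at_z0_is_multiplicative : monoid_morphism at_z0.
Proof.
split=> [|a b]; apply: fpsE => i; first by case: i.
by rewrite fpsC_coefM; case: i => [|i] /=; rewrite ?mulr0 // big_ord1.
Qed.
HB.instance Definition _ :=
  GRing.isZmodMorphism.Build series series at_z0 at_z0_is_additive.
HB.instance Definition _ :=
  GRing.isMonoidMorphism.Build series series at_z0 at_z0_is_multiplicative.

Lemma at_z0_q : at_z0 q = q. Proof. by []. Qed.
Lemma at_z0_z : at_z0 z = 0. Proof. by apply: fpsE => -[|i]. Qed.

Lemma eqm_at_z0 N a b : eqm N a b -> eqm N (at_z0 a) (at_z0 b).
Proof. by move=> ab [|i] j iN jN //=; rewrite ab. Qed.

Lemma summable_qM (T : eqType) n (f : T -> series) :
  summable (fun x => q ^+ n * f x) -> summable f.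
Proof.
(* Dividing by q^n loses n orders of precision in q, hence N + n. *)
move=> sf N; have [D DP] := sf (N + n)%N; exists D => x /DP fx i j iN jN.
have := fx i (j + n)%N; rewrite qXn_coefM fpsXn_coefM addnK leq_addl.
by apply; lia.
Qed.

Lemma summable_leq (T : eqType) (f : T -> series) :
  (forall N, exists D : seq T, forall x, x \notin D ->
     exists n a, (N < n)%N /\ f x = q ^+ n * a) -> summable f.
Proof.
move=> fq N; have [D DP] := fq N; exists D => x /DP[n [a [Nn ->]]].
exact: eqm_qXn.
Qed.

Definition idx := (nat * nat * nat * (nat * nat * nat))%type.

Definition box3 (n : nat) : seq (nat * nat * nat) :=
  [seq (x, k) | x <- [seq (i, j) | i <- iota 0 n.+1, j <- iota 0 n.+1],
                k <- iota 0 n.+1].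

Lemma mem_box3 n i j k :
  (i <= n)%N -> (j <= n)%N -> (k <= n)%N -> (i, j, k) \in box3 n.
Proof. by move=> *; rewrite !allpairs_f // mem_iota. Qed.

(** * The sums S11 *)

(* [qform r s] is never truncated: r^2 - r s + s^2 - r - s + 1 >= 0. *)
Definition qform (r s : nat) : nat := (r ^ 2 + s ^ 2 + 1 - (r * s + r + s))%N.

Lemma addn_total r s :
  (exists t, r = s + t)%N \/ (exists t, s = r + t)%N.
Proof.
case: (leqP s r) => [sr|/ltnW rs]; [left; exists (r - s)%N|right; exists (s - r)%N];
  by lia.
Qed.

Lemma qformE r s : (qform r s + r * s + r + s = r ^ 2 + s ^ 2 + 1)%N.
Proof.
by have [[t ->]|[t ->]] := addn_total r s; rewrite /qform; nia.
Qed.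

Lemma qformC r s : qform r s = qform s r.
Proof. by rewrite /qform; nia. Qed.

(** The exponent bounds the indices even when all a's and b's are 0, that is, for shifts equal to
    -1; this makes the sums converge. The constant 2 reappears in the boxes of [summable_Tterm]. *)
Lemma leq_qform r s : (r <= qform r s + 2)%N.
Proof.
by have := qformE r s; have [[t ->]|[t ->]] := addn_total r s; nia.
Qed.

Lemma qformS r s : (qform r.+1 s + s = qform r s + 2 * r)%N.
Proof. have := qformE r s; have := qformE r.+1 s; nia. Qed.

Definition qwt r s a b : nat := (qform r s + a * r + b * s)%N.

Lemma qwtS r s a b : (qwt r.+1 s a b + s = qwt r s a.+2 b + a)%N.
Proof. rewrite /qwt; have := qformS r s; nia. Qed.

(** Raising r by one adds 2r - s + a to the exponent: a grows by 2 and b drops by 1, which is the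
    pattern of shifts in the contiguity relations. *)
Lemma qwtSS r s a b : (qwt r.+1 s a b.+1 = qwt r s a.+2 b + a)%N.
Proof. have := qwtS r s a b; rewrite /qwt; nia. Qed.

(* The summands are indexed by k = (r1-r2, r2-r3, r3) and l = (s1-s2, s2-s3, s3). *)
Definition Texp a1 a2 a3 b1 b2 b3 (x : idx) : nat :=
  let: (k1, k2, k3, (l1, l2, l3)) := x in
  (qwt (k1 + (k2 + k3)) (l1 + (l2 + l3)) a1 b1
   + qwt (k2 + k3) (l2 + l3) a2 b2 + qwt k3 l3 a3 b3 + 2 * k3 * l3)%N.

(** The variable v marks s1 as u marks r1, so that exchanging r and s stays within the family; the
    theorem is the case u = z, v = 1. *)
Definition Tfac (u v : series) (x : idx) : series :=
  let: (k1, k2, k3, (l1, l2, l3)) := x in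
  u ^+ (k1 + (k2 + k3)) * v ^+ (l1 + (l2 + l3)) *
  (ipoch k1 * ipoch k2 * ipoch k3 * (ipoch l1 * ipoch l2 * ipoch l3)
   * ipoch (k3 + l3 + 1)).

Definition Tterm u v a1 a2 a3 b1 b2 b3 (x : idx) : series :=
  q ^+ Texp a1 a2 a3 b1 b2 b3 x * Tfac u v x.

Definition Tsum u v a1 a2 a3 b1 b2 b3 : series :=
  ssum (Tterm u v a1 a2 a3 b1 b2 b3).

Lemma summable_Tterm u v a1 a2 a3 b1 b2 b3 :
  summable (Tterm u v a1 a2 a3 b1 b2 b3).
Proof.
apply: summable_leq => N.
exists [seq (k, l) | k <- box3 N.+2, l <- box3 N.+2].
move=> [[[k1 k2] k3] [[l1 l2] l3]] xD.
exists (Texp a1 a2 a3 b1 b2 b3 (k1, k2, k3, (l1, l2, l3))); eexists.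
split; last by [].
rewrite ltnNge; apply: contra xD => le_N; rewrite allpairs_f //.
  have := leq_qform (k1 + (k2 + k3)) (l1 + (l2 + l3)).
  by rewrite /Texp /qwt in le_N => ?; apply: mem_box3; lia.
have := leq_qform (l1 + (l2 + l3)) (k1 + (k2 + k3)).
by rewrite qformC /Texp /qwt in le_N * => ?; apply: mem_box3; lia.
Qed.

Definition idx_swap (x : idx) : idx := (x.2, x.1).

Lemma Texp_swap a1 a2 a3 b1 b2 b3 x :
  Texp a1 a2 a3 b1 b2 b3 (idx_swap x) = Texp b1 b2 b3 a1 a2 a3 x.
Proof.
case: x => [[[k1 k2] k3] [[l1 l2] l3]]; rewrite /Texp /qwt /=.
by rewrite (qformC (l1 + _)) (qformC (l2 + _)) (qformC l3); lia.
Qed.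

Lemma Tfac_swap u v x : Tfac u v (idx_swap x) = Tfac v u x.
Proof.
case: x => [[[k1 k2] k3] [[l1 l2] l3]]; rewrite /Tfac /= (addnC l3).
by rewrite (mulrC (u ^+ _)) (mulrC (ipoch l1 * _ * _)).
Qed.

Lemma Tsum_swap u v a1 a2 a3 b1 b2 b3 :
  Tsum u v a1 a2 a3 b1 b2 b3 = Tsum v u b1 b2 b3 a1 a2 a3.
Proof.
have hK : involutive idx_swap by case.
have sf := summable_inj (inv_inj hK) (summable_Tterm u v a1 a2 a3 b1 b2 b3).
have f0 x : (forall y, idx_swap y <> x) -> Tterm u v a1 a2 a3 b1 b2 b3 x = 0.
  by move=> /(_ (idx_swap x)); rewrite hK.
have [_ e] := ssum_reindex (inv_inj hK) f0 sf; apply: etrans e _.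
by apply: eq_ssum => x; rewrite /comp /Tterm Texp_swap Tfac_swap.
Qed.

(** Common core of the three contiguity relations: a factor 1 - q^k kills the terms with k = 0, and
    h raises k by one in the others. *)
Lemma ssum_succ (T T' : choiceType) (h : T' -> T) f c (g : T' -> series) :
  injective h -> (forall x, (forall y, h y <> x) -> f x = 0) ->
  (forall y, f (h y) = c * g y) -> summable g -> ssum f = c * ssum g.
Proof.
move=> hI f0 fh sg; have fhE : f \o h = fun y => c * g y by apply/funext.
have [|_ ->] := ssum_reindex hI f0; first by rewrite fhE; exact: summableM.
by rewrite fhE ssumM.
Qed.

Section Exponents.
Variables (a1 a2 a3 b1 b2 b3 k1 k2 k3 : nat) (l : nat * nat * nat).
Local Notation k := (k1, k2, k3, l).

(** As r1 = r2 + k1, moving a unit of shift from a2 to a1 multiplies a term by q^k1; differences of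
    such terms produce the factor 1 - q^k1. The next lemmas play the same role for k2, k3 and l3. *)
Lemma Texp_a1 : Texp a1.+1 a2 a3 b1 b2 b3 k =
  (Texp a1 a2.+1 a3 b1 b2 b3 k + k1)%N.
Proof. by case: l => [[l1 l2] l3]; rewrite /Texp /qwt; lia. Qed.
Lemma Texp_a2 : Texp a1 a2.+1 a3 b1 b2 b3 k =
  (Texp a1 a2 a3.+1 b1 b2 b3 k + k2)%N.
Proof. by case: l => [[l1 l2] l3]; rewrite /Texp /qwt; lia. Qed.
Lemma Texp_a3 : Texp a1 a2 a3.+1 b1 b2 b3 k =
  (Texp a1 a2 a3 b1 b2 b3 k + k3)%N.
Proof. by case: l => [[l1 l2] l3]; rewrite /Texp /qwt; lia. Qed.
Lemma Texp_b3 : Texp a1 a2 a3 b1 b2 b3.+1 k =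
  (Texp a1 a2 a3 b1 b2 b3 k + l.2)%N.
Proof. by case: l => [[l1 l2] l3]; rewrite /Texp /qwt /=; lia. Qed.

Lemma Texp_succ1 : Texp a1 a2 a3 b1.+1 b2 b3 (k1.+1, k2, k3, l) =
  (a1 + Texp a1.+2 a2 a3 b1 b2 b3 k)%N.
Proof. by case: l => [[l1 l2] l3]; rewrite /Texp addSn qwtSS; lia. Qed.
Lemma Texp_succ2 : Texp a1 a2 a3 b1.+1 b2.+1 b3 (k1, k2.+1, k3, l) =
  (a1 + a2 + Texp a1.+2 a2.+2 a3 b1 b2 b3 k)%N.
Proof.
by case: l => [[l1 l2] l3]; rewrite /Texp addSn addnS !qwtSS; lia.
Qed.
(** The factor q^(2 r3 s3) contributes 2 l3, which turns the -l3 of [qwtS] into +l3: b3 goes up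
    where b1 and b2 go down. *)
Lemma Texp_succ3 : Texp a1 a2 a3 b1.+1 b2.+1 b3 (k1, k2, k3.+1, l) =
  (a1 + a2 + a3 + Texp a1.+2 a2.+2 a3.+2 b1 b2 b3.+1 k)%N.
Proof.
case: l => [[l1 l2] l3]; rewrite /Texp !addnS !qwtSS.
by have := qwtS k3 l3 a3 b3; rewrite /qwt; lia.
Qed.

Variables u v : series.

Lemma Tfac_succ1 :
  (1 - q ^+ k1.+1) * Tfac u v (k1.+1, k2, k3, l) = u * Tfac u v k.
Proof.
case: l => [[l1 l2] l3]; rewrite /Tfac -(ipochS k1) addSn [u ^+ _.+1]exprS.
ring.
Qed.
Lemma Tfac_succ2 :
  (1 - q ^+ k2.+1) * Tfac u v (k1, k2.+1, k3, l) = u * Tfac u v k.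
Proof.
case: l => [[l1 l2] l3].
rewrite /Tfac -(ipochS k2) addSn addnS [u ^+ _.+1]exprS.
ring.
Qed.
Lemma Tfac_succ3 :
  (1 - q ^+ k3.+1) * (1 - q ^+ (k3 + l.2).+2) * Tfac u v (k1, k2, k3.+1, l)
  = u * Tfac u v k.
Proof.
case: l => [[l1 l2] l3]; rewrite /Tfac -(ipochS k3) !addnS !addn0 addSn.
rewrite -(ipochS (k3 + l3).+1) [u ^+ _.+1]exprS.
ring.
Qed.

End Exponents.

Section TsumRelations.
Variables u v : series.
Local Notation t := (Tterm u v).
Local Notation T := (Tsum u v).

Lemma Tsum_contiguous : contiguous q u T.
Proof.
move=> a1 a2 a3 b1 b2 b3; split.
- rewrite /relA1 -ssumB; [|exact: summable_Tterm..].
  pose h (x : idx) : idx := let: (k1, k2, k3, l) := x in (k1.+1, k2, k3, l).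
  rewrite (@ssum_succ _ _ h _ (u * q ^+ a1) (t a1.+2 a2.+1 a3 b1 b2 b3)).
  + by rewrite subrr.
  + by move=> [[[k1 k2] k3] l] [[[k1' k2'] k3'] l'] [-> -> -> ->].
  + move=> [[[[|k1] k2] k3] l] nh; last by case: (nh (k1, k2, k3, l)).
    by rewrite /Tterm Texp_a1 addn0 subrr.
  + move=> [[[k1 k2] k3] l]; rewrite /h {h} /Tterm Texp_a1 Texp_succ1.
    have := Tfac_succ1 k1 k2 k3 l u v; set f := Tfac _ _ _; set g := Tfac _ _ _.
    set E := Texp _ _ _ _ _ _ _ => ef.
    transitivity (q ^+ a1 * q ^+ E * ((1 - q ^+ k1.+1) * f)).
      by rewrite !exprD; ring.
    by rewrite ef; ring.
  + exact: summable_Tterm.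
- rewrite /relA2 -ssumB; [|exact: summable_Tterm..].
  pose h (x : idx) : idx := let: (k1, k2, k3, l) := x in (k1, k2.+1, k3, l).
  rewrite (@ssum_succ _ _ h _ (u * (q ^+ a1 * q ^+ a2))
            (t a1.+2 a2.+2 a3.+1 b1 b2 b3)).
  + by rewrite subrr.
  + by move=> [[[k1 k2] k3] l] [[[k1' k2'] k3'] l'] [-> -> -> ->].
  + move=> [[[k1 [|k2]] k3] l] nh; last by case: (nh (k1, k2, k3, l)).
    by rewrite /Tterm Texp_a2 addn0 subrr.
  + move=> [[[k1 k2] k3] l]; rewrite /h {h} /Tterm Texp_a2 Texp_succ2.
    have := Tfac_succ2 k1 k2 k3 l u v; set f := Tfac _ _ _; set g := Tfac _ _ _.
    set E := Texp _ _ _ _ _ _ _ => ef.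
    transitivity (q ^+ a1 * q ^+ a2 * q ^+ E * ((1 - q ^+ k2.+1) * f)).
      by rewrite !exprD; ring.
    by rewrite ef; ring.
  + exact: summable_Tterm.
have st c1 c2 c3 d1 d2 d3 := summable_Tterm u v c1 c2 c3 d1 d2 d3.
rewrite /relA3 -(ssumM q (st _ _ _ _ _ _)) -(ssumM q (st _ _ _ _ _ _)).
rewrite -!(ssumB, ssumD); do ?[exact: st | apply: summableM | apply: summableD
  | apply: summableN].
pose h (x : idx) : idx := let: (k1, k2, k3, l) := x in (k1, k2, k3.+1, l).
rewrite (@ssum_succ _ _ h _ (u * (q ^+ a1 * q ^+ a2 * q ^+ a3))
          (t a1.+2 a2.+2 a3.+2 b1 b2 b3.+1)).
- by rewrite subrr.
- by move=> [[[k1 k2] k3] l] [[[k1' k2'] k3'] l'] [-> -> -> ->].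
- move=> [[[k1 k2] [|k3]] l] nh; last by case: (nh (k1, k2, k3, l)).
  by rewrite /Tterm !Texp_a3 !addn0; ring.
- move=> [[[k1 k2] k3] l]; rewrite /h {h} /Tterm.
  rewrite ![in LHS](Texp_a3, Texp_b3) Texp_succ3.
  have := Tfac_succ3 k1 k2 k3 l u v; set f := Tfac _ _ _; set g := Tfac _ _ _.
  set E := Texp _ _ _ _ _ _ _ => ef.
  transitivity (q ^+ a1 * q ^+ a2 * q ^+ a3 * q ^+ E *
                ((1 - q ^+ k3.+1) * (1 - q ^+ (k3 + l.2).+2) * f)).
    by rewrite !exprD !exprS !exprD; ring.
  by rewrite ef; ring.
exact: st.
Qed.

End TsumRelations.

Lemma Tsum_bicontiguous : bicontiguous q z (Tsum z 1).
Proof.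
split; first exact: Tsum_contiguous.
suff -> : swap (Tsum z 1) = Tsum 1 z by exact: Tsum_contiguous.
by do 6![apply/funext => ?]; rewrite /swap Tsum_swap.
Qed.

Lemma S11_Tsum a1 a2 a3 b1 b2 b3 :
  q ^+ 3 * S11 (a1, a2, a3) (b1, b2, b3) =
  Tsum z 1 a1.+1 a2.+1 a3.+1 b1.+1 b2.+1 b3.+1.
Proof.
pose h (x : idx) : (nat * nat * nat) * (nat * nat * nat) :=
  let: (k1, k2, k3, (l1, l2, l3)) := x in
  ((k1 + (k2 + k3), k2 + k3, k3), (l1 + (l2 + l3), l2 + l3, l3))%N.
pose t rs := S11_term (a1, a2, a3) (b1, b2, b3) rs.1 rs.2.
have hI : injective h.
  move=> [[[k1 k2] k3] [[l1 l2] l3]] [[[k1' k2'] k3'] [[l1' l2'] l3']].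
  by case=> *; congr (_, _, _, (_, _, _)); lia.
have exp r s a b : (qwt r s a.+1 b.+1 = term_exp r s a b + 1)%N.
  by have := qformE r s; rewrite /qwt /term_exp; nia.
have termE x : q ^+ 3 * t (h x) =
    Tterm z 1 a1.+1 a2.+1 a3.+1 b1.+1 b2.+1 b3.+1 x.
  case: x => [[[k1 k2] k3] [[l1 l2] l3]].
  rewrite /t /S11_term /h /fst /snd !addnK /Tterm /Tfac /Texp !exp.
  rewrite !invrM ?unitrM ?qpoch_unit // -!ipochE expr1n.
  rewrite (_ : _ + 2 * k3 * l3 = 3 +
     (term_exp (k1 + (k2 + k3)) (l1 + (l2 + l3)) a1 b1
      + term_exp (k2 + k3) (l2 + l3) a2 b2 + term_exp k3 l3 a3 b3
      + 2 * k3 * l3))%N;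
    last by lia.
  by rewrite [in RHS]exprD [in RHS]exprD; ring.
have sT := summable_Tterm z 1 a1.+1 a2.+1 a3.+1 b1.+1 b2.+1 b3.+1.
have tq x : Tterm z 1 a1.+1 a2.+1 a3.+1 b1.+1 b2.+1 b3.+1 x = q ^+ 3 * t (h x).
  by rewrite termE.
have st : summable (t \o h).
  by apply: (@summable_qM _ 3); rewrite -(funext tq).
rewrite /Tsum (eq_ssum tq) ssumM //; congr (_ * _).
pose A := [set rs : (nat * nat * nat) * (nat * nat * nat) |
           nonincr3 rs.1 /\ nonincr3 rs.2]%classic.
pose tA rs := if rs \in A then t rs else 0.
have hA x : h x \in A.
  by case: x => [[[k1 k2] k3] [[l1 l2] l3]]; rewrite inE /A /=; lia.
have tAh : tA \o h = t \o h by apply/funext => x; rewrite /tA /= hA.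
have tA0 rs : (forall x, h x <> rs) -> tA rs = 0.
  case: rs => [[[r1 r2] r3] [[s1 s2] s3]] nh; rewrite /tA; case: ifPn => //.
  rewrite inE /A /= => -[/andP[r32 r21] /andP[s32 s21]].
  exfalso; apply: (nh (r1 - r2, r2 - r3, r3, (s1 - s2, s2 - s3, s3))%N).
  by rewrite /h; congr (_, _, _, (_, _, _)); lia.
have [|_ e] := ssum_reindex hI tA0; first by rewrite tAh.
by apply: etrans (series_sum_mkcond _ _) _; apply: etrans e _; rewrite tAh.
Qed.

Lemma dil_Tsum a1 a2 a3 b1 b2 b3 :
  dil (Tsum z 1 a1 a2 a3 b1 b2 b3) = Tsum z 1 a1.+1 a2 a3 b1 b2 b3.
Proof.
rewrite /Tsum (additive_ssum eqm_dil); last exact: summable_Tterm.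
apply: eq_ssum => -[[[k1 k2] k3] [[l1 l2] l3]].
rewrite -[LHS]/(dil _) /Tterm /Tfac (_ : Texp a1.+1 _ _ _ _ _ _ =
  k1 + (k2 + k3) + Texp a1 a2 a3 b1 b2 b3 (k1, k2, k3, (l1, l2, l3)))%N.
  set E := Texp _ _ _ _ _ _ _; rewrite !rmorphM !rmorphXn /= !dil_ipoch.
  by rewrite dil_q dil_z rmorph1 exprMn (exprD q); ring.
by rewrite /Texp /qwt; lia.
Qed.

(** * Infinite products and the value of the sums at z = 0 *)

Lemma series_lim_eqm (u : nat -> series) :
  (forall N n, (N <= n)%N -> eqm N (u n.+1) (u n)) ->
  forall N n, (N <= n)%N -> eqm N (series_lim u) (u n).
Proof.
move=> uS; have stab N m n : (N <= n)%N -> eqm N (u (m + n)%N) (u n).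
  move=> Nn; elim: m => // m IH; rewrite addSn.
  by apply: eqm_trans IH; apply: uS; lia.
move=> N n Nn i j iN jN /=; apply: xget_subset1.
  by exists n => m nm; rewrite -(subnK nm) (stab N).
move=> x y [n1 H1] [n2 H2].
by rewrite -(H1 (maxn n1 n2)) ?leq_maxl // (H2 (maxn n1 n2)) ?leq_maxr.
Qed.

Lemma qpoch_inf_eqm b N n : (N <= n)%N ->
  eqm N (qpoch_inf (b * q)) (qpoch (b * q) n).
Proof.
apply: series_lim_eqm => {}N {}n Nn; rewrite {1}/qpoch big_ord_recr /=.
rewrite -/(qpoch _ n) mulrBr mulr1 -[X in eqm _ _ X]subr0.
apply: eqmD => //; apply: eqmN.
rewrite (_ : qpoch _ n * _ = q ^+ n.+1 * (qpoch (b * q) n * b)); last first.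
  by rewrite exprS; ring.
exact: eqm_qXn.
Qed.

Lemma dil_qpoch_inf : (1 - z * q) * dil (qpoch_inf (z * q)) = qpoch_inf (z * q).
Proof.
apply: eqm_all => N; apply: (@eqm_trans _ (qpoch (z * q) N.+1)); last first.
  by apply: eqm_sym; exact: qpoch_inf_eqm.
rewrite [X in eqm _ _ X]/qpoch big_ord_recl expr0 mulr1; apply: eqmM => //.
apply: eqm_trans (eqm_dil (qpoch_inf_eqm z (leqnn N))) _.
rewrite /qpoch rmorph_prod
  (eq_bigr (fun k : 'I_N => 1 - z * q * q ^+ lift ord0 k)) //.
move=> k _; rewrite rmorphB rmorph1 !rmorphM rmorphXn /= dil_z dil_q.
by rewrite /bump leq0n add1n exprS !mulrA.
Qed.

Lemma qpoch_inf_coef00 b : qpoch_inf (b * q) 0%N 0%N = 1.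
Proof.
rewrite (qpoch_inf_eqm b (leqnn 0) (leqnn 0) (leqnn 0)).
by rewrite /qpoch big_ord0.
Qed.

Lemma qpoch_inf_unit b : qpoch_inf (b * q) \is a GRing.unit.
Proof. by rewrite !fps_unitE qpoch_inf_coef00 unitr1. Qed.

Definition euler : series := (qpoch_inf q)^-1.

Lemma qpoch_infq_unit : qpoch_inf q \is a GRing.unit.
Proof. by have := qpoch_inf_unit 1; rewrite mul1r. Qed.

Lemma ipoch_eqm N n : (N <= n)%N -> eqm N (ipoch n) euler.
Proof.
move=> Nn; rewrite -[ipoch n]mul1r -[1](mulVr qpoch_infq_unit) -mulrA.
rewrite -[X in eqm N _ X]mulr1; apply: eqmM => //.
rewrite -[X in eqm N _ X](mulVr (qpoch_unit n)) mulrC ipochE; apply: eqmM => //.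
by have := qpoch_inf_eqm 1 Nn; rewrite mul1r.
Qed.

Lemma dil_euler : dil euler = euler.
Proof.
apply: eqm_all => N; apply: eqm_trans (ipoch_eqm (leqnn N)).
by rewrite -(dil_ipoch N); apply: eqm_dil; apply: eqm_sym; exact: ipoch_eqm.
Qed.

(* The q-Chu-Vandermonde sum. *)
Lemma ipoch_conv n m :
  \sum_(l < n.+1)
    q ^+ (l ^ 2 + m * l) * (ipoch (n - l) * ipoch l * ipoch (l + m))
  = ipoch n * ipoch (n + m).
Proof.
elim: n m => [|n IH] m.
  by rewrite big_ord1 muln0 addn0 mul1r !ipoch0 mul1r.
apply: (mulrI (unit_1Bq n)).
rewrite [RHS]mulrA ipochS.
pose f m' (l : nat) :=
  q ^+ (l ^ 2 + m' * l) * (ipoch (n - l) * ipoch l * ipoch (l + m')).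
have split1 (l : 'I_n.+2) :
    (1 - q ^+ n.+1) * (q ^+ (l ^ 2 + m * l) *
                       (ipoch (n.+1 - l) * ipoch l * ipoch (l + m))) =
    (if (l < n.+1)%N then f m l else 0) +
    (if nat_of_ord l is k.+1 then q ^+ (n.+1 + m) * f m.+1 k else 0) :> series.
  (* The first summand cancels the last factor of (q)_(n+1-l), the second that of (q)_l; the two
     halves are instances of the induction hypothesis, for m and for m + 1. *)
  have -> : 1 - q ^+ n.+1 =
      (1 - q ^+ (n.+1 - l)) + q ^+ (n.+1 - l) * (1 - q ^+ l).
    by rewrite -{1}(@subnK l n.+1) ?exprD; [ring|have := ltn_ord l; lia].
  rewrite mulrDl; congr (_ + _).
    case: ltnP => [ln|nl]; last first.
      by rewrite (_ : n.+1 - l = 0)%N ?subrr ?mul0r //; lia.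
    by rewrite /f subSn // -(ipochS (n - l)); ring.
  case: l => -[|k] kn /=; first by rewrite subrr mulr0 mul0r.
  rewrite /f subSS addnS -(ipochS k) addSn.
  rewrite (_ : (k.+1 ^ 2 + m * k.+1 = (k ^ 2 + m.+1 * k) + (k + m).+1)%N);
    last by lia.
  rewrite (_ : (n.+1 + m = n - k + (k + m).+1)%N); last by lia.
  by rewrite !exprD; ring.
rewrite big_distrr /= (eq_bigr _ (fun l _ => split1 l)) big_split /=.
rewrite big_ord_recr /= ltnn addr0 [X in _ + X]big_ord_recl /= add0r.
rewrite (eq_bigr (fun l : 'I_n.+1 => f m l)) => [|l _]; last by rewrite ltn_ord.
rewrite IH -big_distrr /= (IH m.+1) addnS -(ipochS (n + m)) addSn.
ring.
Qed.

Lemma ssum_vandermonde (T : choiceType) (w : T -> nat -> series) m :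
  summable (fun x : T * nat * nat => w x.1.1 (x.1.2 + x.2)%N *
    (q ^+ (x.2 ^ 2 + m * x.2) * (ipoch x.1.2 * ipoch x.2 * ipoch (x.2 + m)))) ->
  summable (fun x : T * nat => w x.1 x.2 * (ipoch x.2 * ipoch (x.2 + m))) /\
  ssum (fun x : T * nat * nat => w x.1.1 (x.1.2 + x.2)%N *
    (q ^+ (x.2 ^ 2 + m * x.2) * (ipoch x.1.2 * ipoch x.2 * ipoch (x.2 + m))))
  = ssum (fun x : T * nat => w x.1 x.2 * (ipoch x.2 * ipoch (x.2 + m))).
Proof.
move=> /ssum_antidiag; set g := fun x => \sum_(l < _) _.
suff -> : g = fun x => w x.1 x.2 * (ipoch x.2 * ipoch (x.2 + m)) by [].
apply/funext => -[x n]; rewrite /g /= -ipoch_conv mulr_sumr.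
by apply: eq_bigr => l _; rewrite subnK // -ltnS.
Qed.

Lemma leq_sqr_exp m l N : (N < l)%N -> (N < l ^ 2 + m * l)%N.
Proof. by nia. Qed.

(** The limit n -> oo of [ipoch_conv]. Modulo [eqm N] it suffices to take n = 2N: the terms with l >
    N vanish, and for l <= N one has n - l >= N, so [ipoch (n - l)] is already [euler]. *)
Lemma ssum_euler m :
  ssum (fun n : nat => q ^+ (n ^ 2 + m * n) * (ipoch n * ipoch (n + m))) = euler.
Proof.
have Ue : euler \is a GRing.unit by rewrite unitrV qpoch_infq_unit.
apply: (mulrI Ue); apply: eqm_all => N.
set f := fun n : nat => _.
have fN n : (N < n)%N -> eqm N (f n) 0.
  by move=> Nn; apply: eqm_qXn; exact: leq_sqr_exp.
have fS : eqm N (ssum f) (\sum_(l <- iota 0 (N + N).+1) f l).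
  apply: ssum_eqm; first exact: iota_uniq.
  by move=> l; rewrite mem_iota => lN; apply: fN; lia.
apply: (@eqm_trans _ (euler * \sum_(l <- iota 0 (N + N).+1) f l)).
  by apply: eqmM fS.
apply: (@eqm_trans _ (ipoch (N + N) * ipoch (N + N + m))); last first.
  by apply: eqmM; apply: ipoch_eqm; lia.
rewrite -ipoch_conv mulr_sumr -[iota _ _]/(index_iota 0 (N + N).+1).
rewrite -(big_mkord xpredT (fun l => q ^+ (l ^ 2 + m * l) *
  (ipoch (N + N - l) * ipoch l * ipoch (l + m)))).
apply: eqm_sum => l _; rewrite mulrCA; have [lN|Nl] := leqP l N; last first.
  apply: (@eqm_trans _ 0); last apply: eqm_sym.
    by apply: eqm_qXn; exact: leq_sqr_exp.
  by apply: eqm_qXn; exact: leq_sqr_exp.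
rewrite -mulrA; apply: eqmM => //; apply: eqmM => //.
by apply: eqm_sym; apply: ipoch_eqm; lia.
Qed.

Section ThreefoldDurfee.
Variables (w1 w2 : nat -> series) (m : nat).

Definition durfee_term (x : unit * nat * nat * nat) : series :=
  w1 (x.1.1.2 + (x.1.2 + x.2))%N * w2 (x.1.2 + x.2)%N * ipoch x.1.1.2 *
  (q ^+ (x.2 ^ 2 + m * x.2) * (ipoch x.1.2 * ipoch x.2 * ipoch (x.2 + m))).

(* With w1, w2 the weights q^(n^2+mn) this is the evaluation of the S-sums at
   z = 0 by iterated Durfee squares; the steps may lower m, as
   (1 - q^(n+1)) / (q)_(n+1) = 1 / (q)_n. *)
Lemma ssum_durfee m' m'' :
  (forall n, w2 n * (ipoch n * ipoch (n + m)) =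
             q ^+ (n ^ 2 + m' * n) * (ipoch n * ipoch (n + m'))) ->
  (forall n, w1 n * (ipoch n * ipoch (n + m')) =
             q ^+ (n ^ 2 + m'' * n) * (ipoch n * ipoch (n + m''))) ->
  summable durfee_term -> ssum durfee_term = euler.
Proof.
move=> w2E w1E sV.
have [s2 e2] := @ssum_vandermonde _
  (fun (x : unit * nat) n => w1 (x.2 + n)%N * w2 n * ipoch x.2) m sV.
rewrite [LHS]e2; pose v (x : unit * nat * nat) :=
  w1 (x.1.2 + x.2)%N *
  (q ^+ (x.2 ^ 2 + m' * x.2) * (ipoch x.1.2 * ipoch x.2 * ipoch (x.2 + m'))).
have vE x : w1 (x.1.2 + x.2)%N * w2 x.2 * ipoch x.1.2 *
    (ipoch x.2 * ipoch (x.2 + m)) = v x.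
  transitivity (w1 (x.1.2 + x.2)%N * ipoch x.1.2 *
    (w2 x.2 * (ipoch x.2 * ipoch (x.2 + m)))); first by ring.
  by rewrite w2E /v; ring.
rewrite (eq_ssum vE); move: s2; rewrite (funext vE) => s1.
have [s0 e1] := @ssum_vandermonde _ (fun (_ : unit) n => w1 n) m' s1.
rewrite [LHS]e1; pose h (n : nat) := (tt, n).
have hI : injective h by move=> n n' [].
have [|_ ->] := ssum_reindex hI _ (summable_inj hI s0).
  by move=> [[] n] /(_ n).
by rewrite -(ssum_euler m''); apply: eq_ssum => n; exact: w1E.
Qed.

End ThreefoldDurfee.

(** The summand of S at z = 0, where only r = 0 survives. The factor [unit] in the index type lets
    [ssum_vandermonde], stated over T * nat * nat, apply twice. *)
Definition Vterm b1 b2 b3 (x : unit * nat * nat * nat) : series :=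
  q ^+ ((x.1.1.2 + (x.1.2 + x.2)) ^ 2 + b1 * (x.1.1.2 + (x.1.2 + x.2))) *
  q ^+ ((x.1.2 + x.2) ^ 2 + b2 * (x.1.2 + x.2)) *
  q ^+ (x.2 ^ 2 + b3 * x.2) *
  (ipoch x.1.1.2 * ipoch x.1.2 * ipoch x.2 * ipoch (x.2 + 1)).

Lemma at_z0_qXnM n a : at_z0 (q ^+ n * a) = q ^+ n * at_z0 a.
Proof. by rewrite rmorphM rmorphXn. Qed.

Lemma at_z0_Tfac l1 l2 l3 : at_z0 (Tfac z 1 (0, 0, 0, (l1, l2, l3))%N) =
  ipoch l1 * ipoch l2 * ipoch l3 * ipoch (l3 + 1).
Proof.
rewrite /Tfac !rmorphM !rmorphXn /= !(rmorph_ipoch (phi := at_z0) _ at_z0_q).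
by rewrite rmorph1 expr1n ipoch0 !add0n !mul1r.
Qed.

Lemma qwt0 s a b : (qwt 0 s a b.+1 = s ^ 2 + b * s + 1)%N.
Proof. by have := qformE 0 s; rewrite /qwt; lia. Qed.

Lemma at_z0_Tsum a1 a2 a3 b1 b2 b3 :
  summable (Vterm b1 b2 b3) /\
  at_z0 (Tsum z 1 a1 a2 a3 b1.+1 b2.+1 b3.+1) = q ^+ 3 * ssum (Vterm b1 b2 b3).
Proof.
have sT := summable_Tterm z 1 a1 a2 a3 b1.+1 b2.+1 b3.+1.
pose h (x : unit * nat * nat * nat) : idx := (0, 0, 0, (x.1.1.2, x.1.2, x.2))%N.
have hI : injective h.
  by move=> [[[[] l1] l2] l3] [[[[] l1'] l2'] l3'] [-> -> ->].
pose f x := at_z0 (Tterm z 1 a1 a2 a3 b1.+1 b2.+1 b3.+1 x).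
have sf : summable f := summable_additive eqm_at_z0 sT.
have f0 x : (forall y, h y <> x) -> f x = 0.
  case: x => [[[k1 k2] k3] [[l1 l2] l3]] nh; rewrite /f /Tterm /Tfac.
  rewrite !rmorphM !rmorphXn /= at_z0_z.
  have [k0|k0] := posnP (k1 + (k2 + k3)); last first.
    by rewrite expr0n gtn_eqF // !(mul0r, mulr0).
  exfalso; apply: (nh (tt, l1, l2, l3)); rewrite /h; congr (_, _, _, _); lia.
have fh x : (f \o h) x = q ^+ 3 * Vterm b1 b2 b3 x.
  case: x => [[[[] l1] l2] l3]; rewrite /f /Vterm /comp /h /Tterm /fst /snd.
  rewrite (_ : Texp _ _ _ _ _ _ _ = 3 +
     ((l1 + (l2 + l3)) ^ 2 + b1 * (l1 + (l2 + l3)) +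
      ((l2 + l3) ^ 2 + b2 * (l2 + l3)) + (l3 ^ 2 + b3 * l3)))%N; last first.
    by rewrite /Texp !add0n !qwt0; lia.
  rewrite at_z0_qXnM at_z0_Tfac.
  set e1 := (_ + b1 * _)%N; set e2 := (_ + b2 * _)%N; set e3 := (_ + b3 * _)%N.
  rewrite [q ^+ (3 + _)]exprD [q ^+ (e1 + e2 + e3)]exprD [q ^+ (e1 + e2)]exprD.
  by ring.
have sV : summable (Vterm b1 b2 b3).
  apply: (@summable_qM _ 3); rewrite -(funext fh); exact: summable_inj.
split=> //; rewrite /Tsum (additive_ssum eqm_at_z0 sT) -/f.
have [|_ e] := ssum_reindex hI f0; first exact: summable_inj.
by apply: etrans e _; rewrite (eq_ssum fh) ssumM.
Qed.

Lemma qXn_sqrS n b : q ^+ (n ^ 2 + b.+1 * n) = q ^+ (n ^ 2 + b * n) * q ^+ n.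
Proof. by rewrite -exprD mulSn [(n + _)%N]addnC addnA. Qed.

Lemma Vsum_111 : ssum (Vterm 1 1 1) = euler.
Proof.
have [sV _] := at_z0_Tsum 0 0 0 1 1 1.
pose w n := q ^+ (n ^ 2 + 1 * n).
have VE x : Vterm 1 1 1 x = durfee_term w w 1 x.
  by rewrite /Vterm /durfee_term /w; ring.
rewrite (eq_ssum VE); apply: (@ssum_durfee _ _ _ 1 1) => //.
by rewrite -(funext VE).
Qed.

(** Subtracting q times the sum with sigma_i raised inserts 1 - q^(s_i+1). It turns 1/(q)_(s_i+1)
    into 1/(q)_(s_i), lowering m from 1 to 0 at the stage where the weight becomes q^(s_i^2). Here i
    = 1; the next two lemmas use i = 2 and i = 3. *)
Lemma Vsum_011 : ssum (Vterm 0 1 1) - q * ssum (Vterm 1 1 1) = euler.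
Proof.
have [sV _] := at_z0_Tsum 0 0 0 0 1 1; have [sV' _] := at_z0_Tsum 0 0 0 1 1 1.
pose w1 n := q ^+ (n ^ 2 + 0 * n) * (1 - q ^+ n.+1).
pose w2 n := q ^+ (n ^ 2 + 1 * n).
have VE x : Vterm 0 1 1 x - q * Vterm 1 1 1 x = durfee_term w1 w2 1 x.
  by rewrite /Vterm /durfee_term /w1 /w2 !qXn_sqrS exprS; ring.
rewrite -(ssumM q sV') -(ssumB sV (summableM q sV')).
rewrite (eq_ssum VE); apply: (@ssum_durfee _ _ _ 1 0) => [//|n|].
  by rewrite /w1 addn0 addn1 -mulrA [X in _ * X]mulrCA ipochS.
by rewrite -(funext VE); exact: (summableD sV (summableN (summableM q sV'))).
Qed.

Lemma Vsum_001 : ssum (Vterm 0 0 1) - q * ssum (Vterm 0 1 1) = euler.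
Proof.
have [sV _] := at_z0_Tsum 0 0 0 0 0 1; have [sV' _] := at_z0_Tsum 0 0 0 0 1 1.
pose w1 n := q ^+ (n ^ 2 + 0 * n).
pose w2 n := q ^+ (n ^ 2 + 0 * n) * (1 - q ^+ n.+1).
have VE x : Vterm 0 0 1 x - q * Vterm 0 1 1 x = durfee_term w1 w2 1 x.
  by rewrite /Vterm /durfee_term /w1 /w2 !qXn_sqrS exprS; ring.
rewrite -(ssumM q sV') -(ssumB sV (summableM q sV')).
rewrite (eq_ssum VE); apply: (@ssum_durfee _ _ _ 0 0) => [n|//|].
  by rewrite /w2 addn0 addn1 -mulrA [X in _ * X]mulrCA ipochS.
by rewrite -(funext VE); exact: (summableD sV (summableN (summableM q sV'))).
Qed.

Lemma Vsum_000 : ssum (Vterm 0 0 0) - q * ssum (Vterm 0 0 1) = euler.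
Proof.
have [sV _] := at_z0_Tsum 0 0 0 0 0 0; have [sV' _] := at_z0_Tsum 0 0 0 0 0 1.
pose w n := q ^+ (n ^ 2 + 0 * n).
have VE x : Vterm 0 0 0 x - q * Vterm 0 0 1 x = durfee_term w w 0 x.
  rewrite /Vterm /durfee_term /w addn0 addn1 -(ipochS x.2) !qXn_sqrS exprS.
  ring.
rewrite -(ssumM q sV') -(ssumB sV (summableM q sV')).
rewrite (eq_ssum VE); apply: (@ssum_durfee _ _ _ 0 0) => [//|//|].
by rewrite -(funext VE); exact: (summableD sV (summableN (summableM q sV'))).
Qed.

(** * Cylindric partitions with three rows *)

Definition link c (p p' : seq nat) :=
  forall j, (nth 0 p' (j + c) <= nth 0 p j)%N.

Definition triple := (seq nat * seq nat * seq nat)%type.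

Definition cyl3 (c1 c2 c3 : nat) (t : triple) : Prop :=
  let: (p1, p2, p3) := t in
  (is_partition p1 /\ is_partition p2 /\ is_partition p3) /\
  (link c1 p3 p1 /\ link c2 p1 p2 /\ link c3 p2 p3).

Definition psum (p : seq nat) : nat := (\sum_(x <- p) x)%N.
Definition pmax (p : seq nat) : nat := (\max_(x <- p) x)%N.
Definition wt3 (t : triple) : nat :=
  let: (p1, p2, p3) := t in (psum p1 + (psum p2 + psum p3))%N.
Definition max3 (t : triple) : nat :=
  let: (p1, p2, p3) := t in maxn (pmax p1) (maxn (pmax p2) (pmax p3)).
Definition empty3 : triple := ([::], [::], [::]).

Definition Gterm c1 c2 c3 (t : triple) : series :=
  if `[< cyl3 c1 c2 c3 t >] then z ^+ max3 t * q ^+ wt3 t else 0.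

Lemma leq_psum p x : x \in p -> (x <= psum p)%N.
Proof.
by move=> xp; rewrite /psum (big_rem x xp) leq_addr.
Qed.

Lemma size_psum p : is_partition p -> (size p <= psum p)%N.
Proof.
case/andP=> _; rewrite /psum; elim: p => [|x p IH] //=; rewrite big_cons.
by rewrite inE negb_or => /andP[x0 /IH]; lia.
Qed.

Lemma pmax_head p : is_partition p -> pmax p = head 0%N p.
Proof.
case/andP; rewrite /pmax; case: p => [|x p] /= xp _; first by rewrite big_nil.
rewrite big_cons; apply/maxn_idPl/bigmax_leqP_seq => y yp _.
have /allP := order_path_min (rev_trans leq_trans) xp.
by apply.
Qed.

Lemma pmax_eq0 p : is_partition p -> pmax p = 0%N -> p = [::].
Proof.
move=> pp; rewrite pmax_head //; case/andP: pp => _.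
by case: p => // x p /=; rewrite inE negb_or => /andP[/eqP xn0 _] x0; lia.
Qed.

Fixpoint bounded_seqs (n k : nat) : seq (seq nat) :=
  if k is k'.+1 then
    [::] :: [seq x :: s | x <- iota 0 n.+1, s <- bounded_seqs n k']
  else [:: [::]].

Lemma mem_bounded_seqs n k s :
  (size s <= k)%N -> all (fun x => x <= n)%N s -> s \in bounded_seqs n k.
Proof.
elim: k s => [|k IH] [|x s] // sk /andP[xn sn].
suff: x :: s \in [seq y :: t | y <- iota 0 n.+1, t <- bounded_seqs n k].
  by move=> xs; apply/orP; right.
by apply: allpairs_f; [rewrite mem_iota|exact: IH].
Qed.

Lemma partition_bounded p n :
  is_partition p -> (psum p <= n)%N -> p \in bounded_seqs n n.
Proof.
move=> pp pn; apply: mem_bounded_seqs.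
  by apply: leq_trans pn; exact: size_psum.
by apply/allP => x /leq_psum xp; exact: leq_trans pn.
Qed.

Lemma summable_Gterm c1 c2 c3 : summable (Gterm c1 c2 c3).
Proof.
move=> N; exists [seq (x, p3) | x <- [seq (p1, p2) | p1 <- bounded_seqs N N,
  p2 <- bounded_seqs N N], p3 <- bounded_seqs N N].
move=> [[p1 p2] p3] tD; rewrite /Gterm; case: asboolP => // -[[P1 [P2 P3]] _].
rewrite mulrC; apply: eqm_qXn; rewrite ltnNge; apply: contra tD => /= le_N.
by rewrite !allpairs_f // partition_bounded //; lia.
Qed.

Lemma F_Gterm c1 c2 c3 : F [:: c1; c2; c3] = ssum (Gterm c1 c2 c3).
Proof.
pose h (t : triple) := [:: t.1.1; t.1.2; t.2].
have hI : injective h by move=> [[p1 p2] p3] [[p1' p2'] p3'] [/= -> -> ->].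
rewrite /F series_sum_mkcond; set f := fun x : seq (seq nat) => _.
have cylE t : cylindric [:: c1; c2; c3] (h t) <-> cyl3 c1 c2 c3 t.
  case: t => [[p1 p2] p3]; split.
    case=> _ /and4P[P1 P2 P3 _] L12 L3; split=> //; split=> [|]; last split.
    - by move=> j; have := L3 j.
    - by move=> j; have := L12 0%N j isT.
    - by move=> j; have := L12 1%N j isT.
  move=> [[P1 [P2 P3]] [L1 [L2 L3]]]; split=> //=; first by rewrite P1 P2 P3.
    by move=> [|[|i]] j // _; [exact: L2|exact: L3].
have fh : f \o h = Gterm c1 c2 c3.
  apply/funext => t; rewrite /comp /f /Gterm.
  have -> : (h t \in cylindric [:: c1; c2; c3]) = `[< cyl3 c1 c2 c3 t >].
    by apply/idP/asboolP; rewrite inE; case: (cylE t).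
  case: t => [[p1 p2] p3]; congr (if _ then _ else _).
  rewrite /max_part /weight /h !big_cons !big_nil /max3 /wt3 /psum /pmax.
  by rewrite maxn0 addn0.
have f0 pi : (forall t, h t <> pi) -> f pi = 0.
  move=> npi; rewrite /f; case: ifPn => //; rewrite inE => -[spi _ _ _].
  exfalso; move: spi npi; case: pi => [|p1 [|p2 [|p3 [|//]]]] // _ npi.
  exact: npi (p1, p2, p3) _.
have [|_ e] := ssum_reindex hI f0; first by rewrite fh; exact: summable_Gterm.
by apply: etrans e _; rewrite fh.
Qed.

(** New profile entry between two consecutive rows when the first part is removed from the former
    (a) or the latter (b): the removal shifts the indices of that row by one. This gives the profile
    c(J). *)
Definition step (a b : bool) (c : nat) : nat :=
  match a, b with
  | true, false => c.+1
  | false, true => c.-1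
  | _, _ => c
  end.

Definition addp (a : bool) n (p : seq nat) := if a then n :: p else p.

Lemma nth_pmax p j : (nth 0 p j <= pmax p)%N.
Proof.
have [jp|pj] := ltnP j (size p); last by rewrite nth_default.
by rewrite /pmax (big_rem _ (mem_nth 0%N jp)) leq_maxl.
Qed.

Lemma link_addp n (a b : bool) c p p' : (b -> 0 < c)%N -> (pmax p' <= n)%N ->
  link c (addp a n p) (addp b n p') <-> link (step a b c) p p'.
Proof.
move=> c0 p'n; have p'j j : (nth 0 p' j <= n)%N.
  by apply: leq_trans p'n; exact: nth_pmax.
case: a; case: b c0 => c0; rewrite /addp /step /link.
- split=> L [|j]; [exact: (L 1%N)|exact: (L j.+2)| |exact: L].
  by rewrite add0n; case: c {c0 L}.
- split=> L [|j]; [exact: (L 1%N)| | |].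
  + by have := L j.+2; rewrite addSnnS.
  + by rewrite /= p'j.
  + by rewrite addSnnS; exact: L.
- move/(_ isT): c0; case: c => // c _.
  by split=> L j; have := L j; rewrite addnS.
by [].
Qed.

Lemma partition_cons n p :
  (0 < n)%N -> (pmax p <= n)%N -> is_partition (n :: p) <-> is_partition p.
Proof.
move=> n0 pn; have np : all (geq n) p.
  apply/allP => x xp; apply: leq_trans pn.
  by move/bigmax_leqP_seq: (leqnn (pmax p)); apply.
rewrite /is_partition /= (path_sortedE (rev_trans leq_trans)) np inE.
by case: n n0 {pn np}.
Qed.

Lemma partition_addp (a : bool) n p : (0 < n)%N -> (pmax p <= n)%N ->
  is_partition (addp a n p) <-> is_partition p.
Proof. by case: a => // n0 pn; exact: partition_cons. Qed.

Lemma pmax_cons n p : pmax (n :: p) = maxn n (pmax p).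
Proof. by rewrite /pmax big_cons. Qed.

Lemma pmax_addp (a : bool) n p : (pmax p <= n)%N ->
  pmax (addp a n p) = if a then n else pmax p.
Proof. by case: a => // pn; rewrite pmax_cons; apply/maxn_idPl. Qed.

Lemma psum_addp (a : bool) n p : psum (addp a n p) = (a * n + psum p)%N.
Proof. by case: a; rewrite /psum /= ?big_cons ?mul1n. Qed.

Lemma cyl3_empty c1 c2 c3 : cyl3 c1 c2 c3 empty3.
Proof. by split=> //; split=> [|]; last split; move=> j; rewrite nth_nil. Qed.

Lemma max3_eq0 c1 c2 c3 t : cyl3 c1 c2 c3 t -> max3 t = 0%N -> t = empty3.
Proof.
case: t => [[p1 p2] p3] [[P1 [P2 P3]] _] m0.
have [e1 e2 e3] : [/\ pmax p1 = 0, pmax p2 = 0 & pmax p3 = 0]%N.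
  by move: m0; rewrite /max3; clear; split; lia.
by rewrite (pmax_eq0 P1 e1) (pmax_eq0 P2 e2) (pmax_eq0 P3 e3).
Qed.

Lemma wt3_empty : wt3 empty3 = 0%N.
Proof. by rewrite /wt3 /empty3 /psum big_nil. Qed.
Lemma max3_empty : max3 empty3 = 0%N.
Proof. by rewrite /max3 /empty3 /pmax big_nil. Qed.

(* Some component starting with the largest part has a positive entry in the
   profile: going backwards through zero entries keeps the first part maximal. *)
Lemma exists_top c1 c2 c3 p1 p2 p3 (M := max3 (p1, p2, p3)) :
  cyl3 c1 c2 c3 (p1, p2, p3) -> (0 < c1 + c2 + c3)%N ->
  [|| (0 < c1)%N && (head 0%N p1 == M), (0 < c2)%N && (head 0%N p2 == M)
    | (0 < c3)%N && (head 0%N p3 == M)].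
Proof.
move=> [[P1 [P2 P3]] [L1 [L2 L3]]]; rewrite /M /max3 !pmax_head //.
have := L1 0%N; have := L2 0%N; have := L3 0%N; rewrite !nth0 !add0n.
case: c1 c2 c3 {L1 L2 L3} => [|c1] [|c2] [|c3] //; rewrite ?nth0 /=; lia.
Qed.

Section Layer.
Variables (c1 c2 c3 : nat) (j1 j2 j3 : bool).
Local Notation d1 := (step j3 j1 c1).
Local Notation d2 := (step j1 j2 c2).
Local Notation d3 := (step j2 j3 c3).

(* Cylindric partitions all of whose components in J = (j1, j2, j3) start with the
   largest part; they arise by adding that part to the components in J of a
   cylindric partition with profile (d1, d2, d3). *)
Definition layer_term (t : triple) : series :=
  if [&& `[< cyl3 c1 c2 c3 t >], (0 < max3 t)%N,
         j1 ==> (0 < c1)%N && (head 0%N t.1.1 == max3 t),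
         j2 ==> (0 < c2)%N && (head 0%N t.1.2 == max3 t)
       & j3 ==> (0 < c3)%N && (head 0%N t.2 == max3 t)]
  then z ^+ max3 t * q ^+ wt3 t else 0.

Local Notation k := (j1 + (j2 + j3))%N.

Definition add_layer (x : triple * nat) : triple :=
  let n := (max3 x.1 + x.2)%N in
  (addp j1 n x.1.1.1, addp j2 n x.1.1.2, addp j3 n x.1.2).

(** For x = (t, d), the |J| new parts all equal [max3 t + d]. The share [max3 t] amounts to the
    dilation z -> z q^|J|, and d gives a term of a geometric series in z q^|J|. *)
Definition layer_gf (x : triple * nat) : series :=
  (z * q ^+ k) ^+ x.2 * iter k dil (Gterm d1 d2 d3 x.1).

Lemma wt3_add_layer t d :
  wt3 (add_layer (t, d)) = (k * (max3 t + d) + wt3 t)%N.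
Proof.
case: t => [[p1 p2] p3]; rewrite /add_layer /wt3 /fst /snd !psum_addp.
by rewrite !mulnDl; lia.
Qed.

Lemma layer_term_range t :
  (forall x, add_layer x <> t) -> layer_term t = 0.
Proof.
move=> nt; rewrite /layer_term; case: ifP => // /and5P[_ M0 t1 t2 t3].
exfalso; move: t nt M0 t1 t2 t3 => [[p1 p2] p3]; rewrite /fst /snd.
set M := max3 _ => nt M0 t1 t2 t3.
pose r (j : bool) (p : seq nat) := if j then behead p else p.
have rle j p : (pmax (r j p) <= pmax p)%N.
  by case: j => //; case: p => // x p; rewrite pmax_cons leq_maxr.
have rE j p : (j ==> (head 0%N p == M)) -> addp j M (r j p) = p.
  by case: j => //=; case: p => [|x p] /eqP //= xM; [lia|rewrite xM].
pose t := (r j1 p1, r j2 p2, r j3 p3).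
have tM : (max3 t <= M)%N.
  by have := rle j1 p1; have := rle j2 p2; have := rle j3 p3; rewrite /M /=; lia.
apply: (nt (t, M - max3 t)%N); rewrite /add_layer /fst /snd subnKC //.
rewrite !rE //.
- by move: t3; case: (j3) => //= /andP[].
- by move: t2; case: (j2) => //= /andP[].
- by move: t1; case: (j1) => //= /andP[].
Qed.

Lemma iter_dil_zq m a b :
  iter m dil (z ^+ a * q ^+ b) = z ^+ a * q ^+ (m * a + b).
Proof.
elim: m b => [|m IH] b //=; rewrite IH rmorphM !rmorphXn /= dil_z dil_q.
by rewrite exprMn -mulrA -exprD addnA -mulSn.
Qed.

Hypothesis J_neq0 : [|| j1, j2 | j3].

Lemma max3_add_layer t d : max3 (add_layer (t, d)) = (max3 t + d)%N.
Proof.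
case: t => [[p1 p2] p3]; rewrite /add_layer /=; set n := (_ + d)%N.
have [n1 n2 n3] : [/\ pmax p1 <= n, pmax p2 <= n & pmax p3 <= n]%N.
  by split; rewrite /n /=; lia.
rewrite !pmax_addp //; move: J_neq0.
by case: (j1); case: (j2); case: (j3) => //= _; lia.
Qed.

Lemma add_layer_inj : injective add_layer.
Proof.
move=> [t d] [t' d'] e.
have n : (max3 t + d = max3 t' + d')%N by rewrite -!max3_add_layer e.
have tt' : t = t'.
  case: t t' n e => [[p1 p2] p3] [[p1' p2'] p3'] n; rewrite /add_layer /fst /snd.
  rewrite n; case=> e1 e2 e3; congr (_, _, _).
  - by move: e1; case: (j1) => [[]|].
  - by move: e2; case: (j2) => [[]|].
  - by move: e3; case: (j3) => [[]|].
by move: n; rewrite tt' => /addnI ->.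
Qed.

Hypothesis c1_gt0 : j1 -> (0 < c1)%N.
Hypothesis c2_gt0 : j2 -> (0 < c2)%N.
Hypothesis c3_gt0 : j3 -> (0 < c3)%N.

Lemma cyl3_add_layer t d (n := (max3 t + d)%N) : (0 < n)%N ->
  cyl3 c1 c2 c3 (add_layer (t, d)) <-> cyl3 d1 d2 d3 t.
Proof.
case: t @n => [[p1 p2] p3] n n0.
have [n1 n2 n3] : [/\ pmax p1 <= n, pmax p2 <= n & pmax p3 <= n]%N.
  by split; rewrite /n /=; lia.
rewrite /add_layer /fst /snd -/n /cyl3 !link_addp // !partition_addp //.
Qed.

(** The pair ([empty3], 0) would add parts equal to 0, so it yields no partition, yet it contributes
    1 to the geometric sum; this is the origin of the + 1 in [layer_sumE]. *)
Lemma layer_termE x : layer_term (add_layer x) =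
  layer_gf x - (if x == (empty3, 0%N) then 1 else 0).
Proof.
case: x => t d; rewrite /layer_term max3_add_layer /layer_gf /fst /snd /Gterm.
have hd (j : bool) c p : (j -> 0 < c)%N ->
    j ==> (0 < c)%N && (head 0%N (addp j (max3 t + d) p) == max3 t + d)%N.
  by case: j => //= -> //; rewrite eqxx.
rewrite !hd // !andbT.
have [n0|n0] := posnP (max3 t + d).
  rewrite andbF; have d0 : d = 0%N by lia.
  case: asboolP => ct.
    have t0 : t = empty3 by apply: (max3_eq0 ct); lia.
    rewrite t0 d0 eqxx max3_empty wt3_empty iter_dil_zq.
    by rewrite muln0 !expr0 !mul1r subrr.
  have iter0 : iter k dil 0 = 0 by elim: k => //= m ->; rewrite rmorph0.
  rewrite iter0 mulr0 ifN ?subr0 //; apply/eqP => -[t0 _]; apply: ct.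
  by rewrite t0; exact: cyl3_empty.
rewrite andbT [X in _ - X]ifN; last first.
  by apply/eqP => -[t0 d0]; rewrite t0 d0 max3_empty in n0.
rewrite (asbool_equiv_eq (cyl3_add_layer n0)) subr0; case: ifP => _.
  rewrite iter_dil_zq wt3_add_layer exprMn -exprM exprD.
  rewrite mulnDr -addnA [in q ^+ _]addnA !exprD; ring.
have iter0 : iter k dil 0 = 0 by elim: k => //= m ->; rewrite rmorph0.
by rewrite iter0 mulr0.
Qed.

End Layer.

Lemma ssum_geometric (T : choiceType) (g : T -> series) (b : series) :
  summable g ->
  summable (fun x : T * nat => (z * b) ^+ x.2 * g x.1) /\
  (1 - z * b) * ssum (fun x : T * nat => (z * b) ^+ x.2 * g x.1) = ssum g.
Proof.
move=> sg; set f := fun x : T * nat => _.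
have fD N (D : seq T) : (forall x, x \notin D -> eqm N (g x) 0) ->
    forall x, x \notin [seq (y, d) | y <- D, d <- iota 0 N.+1] -> eqm N (f x) 0.
  move=> gD [x d] xD; have [xin|xnin] := boolP (x \in D); last first.
    by apply: eqm_mul0; exact: gD.
  rewrite /f exprMn -mulrA; apply: eqm_zXn; rewrite ltnNge /=.
  by apply: contra xD => dN; apply: allpairs_f; rewrite ?mem_iota.
have sf : summable f by move=> N; have [D gD] := sg N; eexists; exact: fD gD.
split; first exact: sf.
apply: eqm_all => N.
have [D uD gD] := summable_uniq N sg.
pose E := [seq (y, d) | y <- D, d <- iota 0 N.+1].
have uE : uniq E.
  apply: allpairs_uniq => //; first exact: iota_uniq.
  by case=> ? ? [? ?] _ _ [-> ->].
apply: (@eqm_trans _ ((1 - z * b) * \sum_(x <- E) f x)).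
  by apply: eqmM => //; exact: (ssum_eqm uE (fD N D gD)).
have -> : \sum_(x <- E) f x = (\sum_(i < N.+1) (z * b) ^+ i) * \sum_(x <- D) g x.
  rewrite big_allpairs mulr_sumr; apply: eq_bigr => x _.
  by rewrite -[iota 0 N.+1]/(index_iota 0 N.+1) big_mkord mulr_suml.
rewrite mulrA -opprB mulNr -subrX1 opprB exprMn.
apply: (@eqm_trans _ (1 * \sum_(x <- D) g x)).
  apply: eqmM => //; rewrite -[X in eqm _ _ X]subr0.
  by apply: eqmD => //; apply: eqmN; exact: eqm_zXn.
by rewrite mul1r; apply: eqm_sym; exact: ssum_eqm.
Qed.

Lemma iter_dil_eqm k N a b : eqm N a b -> eqm N (iter k dil a) (iter k dil b).
Proof. by move=> ab; elim: k => //= k; exact: eqm_dil. Qed.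

Fact iter_dil_is_additive k : zmod_morphism (iter k dil).
Proof. by move=> a b; elim: k => //= k ->; rewrite rmorphB. Qed.
Fact iter_dil_is_multiplicative k : monoid_morphism (iter k dil).
Proof.
by split=> [|a b]; elim: k => //= k ->; rewrite (rmorph1, rmorphM).
Qed.
HB.instance Definition _ k := GRing.isZmodMorphism.Build series series
  (iter k dil) (iter_dil_is_additive k).
HB.instance Definition _ k := GRing.isMonoidMorphism.Build series series
  (iter k dil) (iter_dil_is_multiplicative k).

Section LayerSum.
Variables (c1 c2 c3 : nat) (j1 j2 j3 : bool).
Local Notation d1 := (step j3 j1 c1).
Local Notation d2 := (step j1 j2 c2).
Local Notation d3 := (step j2 j3 c3).
Local Notation k := (j1 + (j2 + j3))%N.

Definition layer_sum := ssum (layer_term c1 c2 c3 j1 j2 j3).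

Lemma summable_layer_term : summable (layer_term c1 c2 c3 j1 j2 j3).
Proof.
apply: summable_sub (summable_Gterm c1 c2 c3) => N t.
by rewrite /layer_term /Gterm; case: asboolP => //= _; case: ifP.
Qed.

Lemma layer_sum0 :
  ~~ [&& j1 ==> (0 < c1)%N, j2 ==> (0 < c2)%N & j3 ==> (0 < c3)%N] ->
  layer_sum = 0.
Proof.
move=> nc; rewrite /layer_sum -[RHS](ssum0 triple); apply: eq_ssum => t.
rewrite /layer_term ifN //; apply: contra nc => /and5P[_ _].
by case: (j1) => [/andP[-> _]|_]; case: (j2) => [/andP[-> _]|_];
  case: (j3) => // /andP[->].
Qed.

Lemma layer_sumE :
  [&& j1 ==> (0 < c1)%N, j2 ==> (0 < c2)%N & j3 ==> (0 < c3)%N] ->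
  [|| j1, j2 | j3] ->
  (1 - z * q ^+ k) * (layer_sum + 1) = iter k dil (F [:: d1; d2; d3]).
Proof.
case/and3P=> /implyP c10 /implyP c20 /implyP c30 J0.
have sG := summable_Gterm d1 d2 d3.
have sg := summable_additive (phi := iter k dil) (@iter_dil_eqm k) sG.
have [sl el] := ssum_geometric (q ^+ k) sg.
rewrite F_Gterm (additive_ssum (phi := iter k dil) (@iter_dil_eqm k) sG).
rewrite -[RHS]el; congr (_ * _).
pose delta (x : triple * nat) : series := if x == (empty3, 0%N) then 1 else 0.
have sd : summable delta.
  move=> N; exists [:: (empty3, 0%N)] => x.
  by rewrite inE /delta => /negPf ->.
have lE x : (layer_term c1 c2 c3 j1 j2 j3 \o add_layer j1 j2 j3) x =
    layer_gf c1 c2 c3 j1 j2 j3 x - delta x.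
  exact: layer_termE.
have sld : summable (layer_term c1 c2 c3 j1 j2 j3 \o add_layer j1 j2 j3).
  exact: (summable_inj (add_layer_inj J0) summable_layer_term).
have [_ e] := ssum_reindex (add_layer_inj J0)
  (@layer_term_range c1 c2 c3 j1 j2 j3) sld.
rewrite /layer_sum e (eq_ssum lE) (ssumB sl sd).
rewrite (_ : ssum delta = 1) ?subrK //.
rewrite (@ssum1 _ (empty3, 0%N)) /delta ?eqxx // => x /negPf -> //.
Qed.

End LayerSum.

(* Inclusion-exclusion over the nonempty set of components starting with the
   largest part. *)
Lemma Gterm_layers c1 c2 c3 t : (0 < c1 + c2 + c3)%N ->
  Gterm c1 c2 c3 t = (if t == empty3 then 1 else 0)
  + (layer_term c1 c2 c3 true false false t
     + layer_term c1 c2 c3 false true false t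
     + layer_term c1 c2 c3 false false true t)
  - (layer_term c1 c2 c3 true true false t
     + layer_term c1 c2 c3 false true true t
     + layer_term c1 c2 c3 true false true t)
  + layer_term c1 c2 c3 true true true t.
Proof.
move=> c0; rewrite /Gterm /layer_term; case: asboolP => ct; last first.
  rewrite ifN /= ?(addr0, oppr0) //.
  by apply/eqP => t0; apply: ct; rewrite t0; exact: cyl3_empty.
have [m0|m0] := posnP (max3 t).
  by rewrite (max3_eq0 ct m0) eqxx wt3_empty max3_empty mulr1 /= ?(addr0, oppr0).
have -> : (t == empty3) = false.
  by apply/eqP => t0; rewrite t0 max3_empty in m0.
case: t ct m0 => [[p1 p2] p3] ct m0; have := exists_top ct c0.
rewrite /fst /snd /=; set M := maxn _ _; set X := _ * _.
case: (_ && _); case: (_ && _); case: (_ && _) => //= _; ring.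
Qed.

Lemma F_layers c1 c2 c3 : (0 < c1 + c2 + c3)%N ->
  F [:: c1; c2; c3] = 1
  + (layer_sum c1 c2 c3 true false false + layer_sum c1 c2 c3 false true false
     + layer_sum c1 c2 c3 false false true)
  - (layer_sum c1 c2 c3 true true false + layer_sum c1 c2 c3 false true true
     + layer_sum c1 c2 c3 true false true)
  + layer_sum c1 c2 c3 true true true.
Proof.
move=> c0; rewrite F_Gterm (eq_ssum (fun t => Gterm_layers t c0)).
pose delta (t : triple) : series := if t == empty3 then 1 else 0.
have sd : summable delta.
  move=> N; exists [:: empty3] => t.
  by rewrite inE /delta => /negPf ->.
have sl i j k := @summable_layer_term c1 c2 c3 i j k.
have s1 := summableD (summableD (sl true false false) (sl false true false))
  (sl false false true).
have s2 := summableD (summableD (sl true true false) (sl false true true))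
  (sl true false true).
have s3 := summableD (summableD sd s1) (summableN s2).
rewrite (ssumD s3 (sl true true true)) (ssumB (summableD sd s1) s2).
rewrite (ssumD sd s1) (ssumD (summableD (sl _ _ _) (sl _ _ _)) (sl _ _ _)).
rewrite (ssumD (summableD (sl true true false) (sl false true true))
  (sl true false true)).
rewrite !(ssumD (sl _ _ _) (sl _ _ _)) (_ : ssum delta = 1) //.
rewrite (@ssum1 _ empty3) /delta ?eqxx // => x /negPf -> //.
Qed.

(** * The Corteel-Welsh recursion *)

Definition prefactor : series := qpoch_inf (z * q) / qpoch_inf q.

Lemma iter_dil_prefactor k :
  (1 - z * q ^+ k.+1) * iter k.+1 dil prefactor = iter k dil prefactor.
Proof.
have e : (1 - z * q) * dil prefactor = prefactor.
  rewrite /prefactor -/euler rmorphM mulrA /= dil_qpoch_inf.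
  by rewrite dil_euler.
rewrite -[in RHS]e [RHS]rmorphM [X in _ = X * _]rmorphB rmorph1 iterSr.
congr ((1 - _) * _).
by have := iter_dil_zq k 1 1; rewrite !expr1 muln1 addn1 => <-.
Qed.

Lemma prefactor_prod m :
  prefactor = \prod_(i < m) (1 - z * q ^+ i.+1) * iter m dil prefactor.
Proof.
elim: m => [|m IH]; first by rewrite big_ord0 mul1r.
by rewrite big_ord_recr /= -mulrA iter_dil_prefactor.
Qed.

(** Dilating the prefactor |J| times splits off |J| factors 1 - z q^i. The last one clears the
    denominator of the geometric series in [layer_sumE], and the others form (zq;q)_(|J|-1). *)
Lemma prefactor_layer c1 c2 c3 (j1 j2 j3 : bool) :
  [|| j1, j2 | j3] ->
  prefactor * layer_sum c1 c2 c3 j1 j2 j3 =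
  if [&& j1 ==> (0 < c1)%N, j2 ==> (0 < c2)%N & j3 ==> (0 < c3)%N] then
    \prod_(i < (j1 + (j2 + j3)).-1) (1 - z * q ^+ i.+1) *
    iter (j1 + (j2 + j3)) dil
      (H [:: step j3 j1 c1; step j1 j2 c2; step j2 j3 c3]) - prefactor
  else 0.
Proof.
move=> J0; case: ifPn => [ok|/layer_sum0 ->]; last by rewrite mulr0.
have := layer_sumE ok J0; case k: (j1 + (j2 + j3))%N => [|m].
  by move: k J0; case: (j1); case: (j2); case: (j3).
move=> e; apply/eqP; rewrite eq_sym subr_eq; apply/eqP.
rewrite -[X in _ + X]mulr1 -mulrDr (prefactor_prod m.+1) big_ord_recr /=.
rewrite -!mulrA; congr (_ * _).
rewrite [X in _ = _ * X]mulrC mulrA e mulrC -[RHS](rmorphM (iter m.+1 dil)) //.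
Qed.

(** The terms - [prefactor] from [prefactor_layer] cancel the contribution of the empty partition,
    because the signs (-1)^(|J|-1) over the nonempty subsets J of a nonempty set sum to 1. *)
Lemma corteel_welsh c1 c2 c3 : (0 < c1 + c2 + c3)%N ->
  H [:: c1; c2; c3] =
  cw_rhs q z (fun a b c => dil (H [:: a; b; c]))
    (fun a b c => dil (dil (H [:: a; b; c])))
    (fun a b c => dil (dil (dil (H [:: a; b; c])))) c1 c2 c3.
Proof.
move=> c0; rewrite {1}/H -/prefactor F_layers //.
rewrite mulrDr mulrBr !(mulrDr prefactor) mulr1 !prefactor_layer // /cw_rhs.
case: c1 c2 c3 c0 => [|c1] [|c2] [|c3] // _ /=;
  rewrite ?big_ord0 ?big_ord_recr /= ?big_ord0; ring.
Qed.

(** * Uniqueness and the theorem *)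

Lemma at_z0_euler : at_z0 euler = euler.
Proof.
apply: eqm_all => N; apply: eqm_trans (ipoch_eqm (leqnn N)).
rewrite -(rmorph_ipoch (phi := at_z0) N at_z0_q); apply: eqm_at_z0.
by apply: eqm_sym; exact: ipoch_eqm.
Qed.

Lemma at_z0_qpoch_inf : at_z0 (qpoch_inf (z * q)) = 1.
Proof.
apply: eqm_all => N; have := eqm_at_z0 (qpoch_inf_eqm z (leqnn N)).
suff -> : at_z0 (qpoch (z * q) N) = 1 by [].
rewrite /qpoch rmorph_prod big1 // => k _.
by rewrite rmorphB rmorph1 !rmorphM /= at_z0_z !mul0r subr0.
Qed.

Lemma at_z0_F c1 c2 c3 : at_z0 (F [:: c1; c2; c3]) = 1.
Proof.
rewrite F_Gterm (additive_ssum eqm_at_z0 (summable_Gterm c1 c2 c3)).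
rewrite (@ssum1 _ empty3) => [|t tn0]; rewrite -[LHS]/(at_z0 _) /Gterm.
  case: asboolP => [_|[]]; last exact: cyl3_empty.
  by rewrite max3_empty wt3_empty mul1r rmorph1.
case: asboolP => [ct|_]; last by rewrite rmorph0.
rewrite rmorphM !rmorphXn /= at_z0_z expr0n; have [m0|] := eqVneq (max3 t) 0%N.
  by rewrite (max3_eq0 ct m0) eqxx in tn0.
by rewrite mul0r.
Qed.

Lemma at_z0_H c1 c2 c3 : at_z0 (H [:: c1; c2; c3]) = euler.
Proof.
rewrite /H -/euler !rmorphM /= at_z0_qpoch_inf at_z0_euler at_z0_F.
by rewrite mul1r mulr1.
Qed.

(* For fixed n and j this condition defines an ideal. *)
Definition vanishing n j (a : series) :=
  (forall i, (i < n)%N -> a i = 0) /\ (forall j', (j' <= j)%N -> a n j' = 0).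

Lemma vanishing0 n j : vanishing n j 0. Proof. by []. Qed.

Lemma vanishingD n j a b :
  vanishing n j a -> vanishing n j b -> vanishing n j (a + b).
Proof.
move=> [a1 a2] [b1 b2]; split=> [i ilt|j' jle]; rewrite !fps_coefD.
  by rewrite a1 // b1 // addr0.
by rewrite a2 // b2 // addr0.
Qed.

Lemma vanishingM n j c a : vanishing n j a -> vanishing n j (c * a).
Proof.
move=> [a1 a2]; split=> [i ilt|j' jle].
  by rewrite fps_coefM big1 // => k _; rewrite a1 ?mulr0 //; lia.
rewrite fps_coefM fps_coef_sum big1 // => k _.
have [k0|k0] := posnP k; last by rewrite a1 ?mulr0 //; have := ltn_ord k; lia.
by rewrite k0 subn0 fps_coefM big1 // => l _; rewrite a2 ?mulr0 //; lia.
Qed.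

Lemma vanishingN n j a : vanishing n j a -> vanishing n j (- a).
Proof. by rewrite -mulN1r; exact: vanishingM. Qed.

Lemma vanishing_dil n j a : vanishing n j a -> vanishing n j (dil a).
Proof.
move=> [a1 a2]; split=> [i ilt|j' jle].
  by rewrite -[LHS]/(fpsX int ^+ i * a i) a1 // mulr0.
rewrite -[LHS]/((fpsX int ^+ n * a n) j') fpsXn_coefM.
by case: ifP => // _; apply: a2; lia.
Qed.

(** Dilation multiplies the coefficient of z^n by q^n, so for n > 0 it gains at least one order in
    q. This gain drives the inner induction of [cw_unique]. *)
Lemma vanishing_dil_strict n j (a : series) : (0 < n)%N ->
  (forall i, (i < n)%N -> a i = 0) -> (forall j', (j' < j)%N -> a n j' = 0) ->
  vanishing n j (dil a).
Proof.
move=> n0 a1 a2; split=> [i ilt|j' jle].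
  by rewrite -[LHS]/(fpsX int ^+ i * a i) a1 // mulr0.
rewrite -[LHS]/((fpsX int ^+ n * a n) j') fpsXn_coefM.
by case: ifP => // nj; apply: a2; lia.
Qed.

Lemma vanishing_cw n j l (G1 G2 G3 : nat -> nat -> nat -> series) :
  let small G := forall d1 d2 d3, (d1 + d2 + d3 = l)%N ->
    vanishing n j (G d1 d2 d3) in
  small G1 -> small G2 -> small G3 -> forall c1 c2 c3, (c1 + c2 + c3 = l)%N ->
  vanishing n j (cw_rhs q z G1 G2 G3 c1 c2 c3).
Proof.
move=> small s1 s2 s3 c1 c2 c3 e; have v0 := vanishing0 n j; rewrite /cw_rhs.
apply: vanishingD; last first.
  apply: vanishingM; case: c1 e => [|?] e //; case: c2 e => [|?] e //.
  by case: c3 e => [|?] e //; exact: s3.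
apply: vanishingD; last first.
  apply: vanishingN; apply: vanishingM.
  apply: vanishingD; first apply: vanishingD.
  - by case: c1 e => [|?] e //; case: c2 e => [|?] e //; apply: s2; lia.
  - by case: c2 e => [|?] e //; case: c3 e => [|?] e //; apply: s2; lia.
  - by case: c3 e => [|?] e //; case: c1 e => [|?] e //; apply: s2; lia.
apply: vanishingD; first apply: vanishingD.
- by case: c1 e => [|?] e //; apply: s1; lia.
- by case: c2 e => [|?] e //; apply: s1; lia.
- by case: c3 e => [|?] e //; apply: s1; lia.
Qed.

Lemma cw_unique l (D : nat -> nat -> nat -> series) :
  (forall c1 c2 c3, (c1 + c2 + c3 = l)%N -> D c1 c2 c3 =
     cw_rhs q z (fun a b c => dil (D a b c)) (fun a b c => dil (dil (D a b c)))
       (fun a b c => dil (dil (dil (D a b c)))) c1 c2 c3) ->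
  (forall c1 c2 c3, (c1 + c2 + c3 = l)%N -> at_z0 (D c1 c2 c3) = 0) ->
  forall c1 c2 c3, (c1 + c2 + c3 = l)%N -> D c1 c2 c3 = 0.
Proof.
move=> Dcw D0.
have Dn n : forall c1 c2 c3, (c1 + c2 + c3 = l)%N -> D c1 c2 c3 n = 0.
  elim/ltn_ind: n => -[_ c1 c2 c3 cl|n IHn c1 c2 c3 cl].
    by have /fpsP/(_ 0%N) := D0 _ _ _ cl.
  apply: fpsE => j; elim/ltn_ind: j c1 c2 c3 cl => j IHj c1 c2 c3 cl.
  have v1 d1 d2 d3 : (d1 + d2 + d3 = l)%N ->
      vanishing n.+1 j (dil (D d1 d2 d3)).
    move=> dl; apply: vanishing_dil_strict => // [i ilt|j' jlt].
      exact: IHn.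
    exact: IHj.
  suff [_] : vanishing n.+1 j (D c1 c2 c3) by apply.
  rewrite Dcw //; apply: (vanishing_cw (l := l)) => // d1 d2 d3 dl.
    by apply: vanishing_dil; exact: v1.
  by do 2!apply: vanishing_dil; exact: v1.
by move=> c1 c2 c3 cl; apply: fpsE => n; exact: Dn.
Qed.

Lemma dil_rep_sum y T c1 c2 c3 : dil y = y * q ->
  (forall a1 a2 a3 b1 b2 b3,
     dil (T a1 a2 a3 b1 b2 b3) = T a1.+1 a2 a3 b1 b2 b3) ->
  dil (rep_sum q y T c1 c2 c3) = rep_sum q (y * q) (shift T) c1 c2 c3.
Proof.
move=> dy dT.
rewrite /rep_sum /shift.
repeat match goal with
  |- context [match ?x with 0%N => _ | _ => _ end] => is_var x; destruct x
end;
  rewrite ?(rmorphD, rmorphN, rmorphM, rmorph0, rmorph1) /= ?(dT, dil_q, dy) //.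
Qed.

Lemma dil_profile_sum y T c1 c2 c3 : dil y = y * q ->
  (forall a1 a2 a3 b1 b2 b3,
     dil (T a1 a2 a3 b1 b2 b3) = T a1.+1 a2 a3 b1 b2 b3) ->
  dil (profile_sum q y T c1 c2 c3) = profile_sum q (y * q) (shift T) c1 c2 c3.
Proof. by move=> dy dT; rewrite /profile_sum !rmorphD /= !dil_rep_sum. Qed.

Lemma Tsum_cw c1 c2 c3 (G := profile_sum q z (Tsum z 1)) :
  (c1 + c2 + c3 = 8)%N -> G c1 c2 c3 =
  cw_rhs q z (fun a b c => dil (G a b c)) (fun a b c => dil (dil (G a b c)))
    (fun a b c => dil (dil (dil (G a b c)))) c1 c2 c3.
Proof.
move=> c8; apply/eqP; rewrite -subr_eq0; apply/eqP.
rewrite -[RHS](cw_gap_eq0 Tsum_bicontiguous c8) /cw_gap.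
have d1 : (fun a b c => dil (G a b c)) = profile_sum q (z * q) (shift (Tsum z 1)).
  do 3![apply/funext => ?]; apply: dil_profile_sum => [|*]; last exact: dil_Tsum.
  exact: dil_z.
have d2 : (fun a b c => dil (dil (G a b c))) =
    profile_sum q (z * q * q) (shift (shift (Tsum z 1))).
  do 3![apply/funext => ?]; rewrite (congr1 (fun f => dil (f _ _ _)) d1).
  apply: dil_profile_sum => [|*]; last exact: dil_Tsum.
  by rewrite rmorphM /= dil_z dil_q.
have d3 : (fun a b c => dil (dil (dil (G a b c)))) =
    profile_sum q (z * q * q * q) (shift (shift (shift (Tsum z 1)))).
  do 3![apply/funext => ?]; rewrite (congr1 (fun f => dil (f _ _ _)) d2).
  apply: dil_profile_sum => [|*]; last exact: dil_Tsum.
  by rewrite !rmorphM /= dil_z dil_q.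
by rewrite d1 d2 d3.
Qed.

Lemma at_z0_profile_sum c1 c2 c3 : (c1 + c2 + c3 = 8)%N ->
  at_z0 (profile_sum q z (Tsum z 1) c1 c2 c3) = q ^+ 3 * euler.
Proof.
pose V b1 b2 b3 := q ^+ 3 * ssum (Vterm b1 b2 b3).
have V111 : V 1%N 1%N 1%N = q ^+ 3 * euler by rewrite /V Vsum_111.
move=> c8; rewrite -V111; apply: (rmorph_profile_sum (phi := at_z0)) => //.
- exact: at_z0_z.
- by move=> *; exact: (at_z0_Tsum _ _ _ _ _ _).2.
- by rewrite [RHS]V111 -Vsum_011 [RHS]mulrBr [q ^+ 3 * (q * _)]mulrCA.
- by rewrite [RHS]V111 -Vsum_001 [RHS]mulrBr [q ^+ 3 * (q * _)]mulrCA.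
- by rewrite [RHS]V111 -Vsum_000 [RHS]mulrBr [q ^+ 3 * (q * _)]mulrCA.
Qed.

Lemma H_profile_sum c1 c2 c3 : (c1 + c2 + c3 = 8)%N ->
  q ^+ 3 * H [:: c1; c2; c3] = profile_sum q z (Tsum z 1) c1 c2 c3.
Proof.
pose D a b c := q ^+ 3 * H [:: a; b; c] - profile_sum q z (Tsum z 1) a b c.
move=> c8; apply/eqP; rewrite -subr_eq0; apply/eqP; rewrite -/(D c1 c2 c3).
have dilD x y : dil (q ^+ 3 * x - y) = q ^+ 3 * dil x - dil y.
  by rewrite rmorphB rmorphM rmorphXn /= dil_q.
have at_z0D x y : at_z0 (q ^+ 3 * x - y) = q ^+ 3 * at_z0 x - at_z0 y.
  by rewrite rmorphB rmorphM rmorphXn.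
apply: (cw_unique (l := 8)) c8 => {}c1 {}c2 {}c3 c8; last first.
  by rewrite /D at_z0D at_z0_H at_z0_profile_sum ?subrr.
have dil1 : (fun a b c => dil (D a b c)) = fun a b c =>
    q ^+ 3 * dil (H [:: a; b; c]) - dil (profile_sum q z (Tsum z 1) a b c).
  by do 3!apply/funext => ?; exact: dilD.
have dil2 : (fun a b c => dil (dil (D a b c))) = fun a b c =>
    q ^+ 3 * dil (dil (H [:: a; b; c]))
    - dil (dil (profile_sum q z (Tsum z 1) a b c)).
  by do 3!apply/funext => ?; rewrite -dilD -dilD.
have dil3 : (fun a b c => dil (dil (dil (D a b c)))) = fun a b c =>
    q ^+ 3 * dil (dil (dil (H [:: a; b; c])))
    - dil (dil (dil (profile_sum q z (Tsum z 1) a b c))).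
  by do 3!apply/funext => ?; rewrite -!dilD.
by rewrite dil1 dil2 dil3 cw_rhs_linear -corteel_welsh ?c8 // -Tsum_cw.
Qed.

Lemma H_eq c1 c2 c3 a : (c1 + c2 + c3 = 8)%N ->
  q ^+ 3 * a = profile_sum q z (Tsum z 1) c1 c2 c3 -> H [:: c1; c2; c3] = a.
Proof.
move=> /H_profile_sum <- e; do 3!apply: mulq_inj.
by move: e; rewrite !exprS !mulr1 -!mulrA => ->.
Qed.

Lemma mulr_subM (R : comNzRingType) (k c a b a' b' : R) :
  k * a = a' -> k * b = b' -> k * (a - c * b) = a' - c * b'.
Proof. by move=> <- <-; ring. Qed.

Lemma mulr_addM (R : comNzRingType) (k c a b a' b' : R) :
  k * a = a' -> k * b = b' -> k * (a + c * b) = a' + c * b'.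
Proof. by move=> <- <-; ring. Qed.

Ltac S11_eq :=
  apply: H_eq; [reflexivity|rewrite profile_sum_rep; [|reflexivity..]];
  rewrite /rep_sum; repeat first [apply: mulr_subM|apply: mulr_addM];
  apply: S11_Tsum.

Theorem theorem4p3 :
  H [:: 8; 0; 0]%N = S11 (1,1,1)%N (1,1,1)%N /\
  H [:: 7; 1; 0]%N = S11 (0,1,1)%N (1,1,1)%N /\
  H [:: 7; 0; 1]%N = S11 (1,1,1)%N (0,1,1)%N - q * (1 - z) * S11 (2,1,1)%N (1,1,1)%N /\
  H [:: 6; 2; 0]%N = S11 (0,0,1)%N (1,1,1)%N /\
  H [:: 6; 1; 1]%N = S11 (0,1,1)%N (0,1,1)%N - q * S11 (1,1,1)%N (1,1,1)%N /\
  H [:: 6; 0; 2]%N = S11 (1,1,1)%N (0,0,1)%N - q * (1 - z) * S11 (2,1,1)%N (0,1,1)%N /\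
  H [:: 5; 3; 0]%N = S11 (0,0,0)%N (1,1,1)%N /\
  H [:: 5; 2; 1]%N = S11 (0,0,1)%N (0,1,1)%N - q * S11 (0,1,1)%N (1,1,1)%N /\
  H [:: 5; 1; 2]%N = S11 (0,1,1)%N (0,0,1)%N - q * S11 (1,1,1)%N (0,1,1)%N /\
  H [:: 5; 0; 3]%N = S11 (1,1,1)%N (0,0,0)%N - q * (1 - z) * S11 (2,1,1)%N (0,0,1)%N /\
  H [:: 4; 3; 1]%N = S11 (0,0,0)%N (0,1,1)%N - q * S11 (0,0,1)%N (1,1,1)%N /\
  H [:: 4; 2; 2]%N = S11 (0,0,1)%N (0,0,1)%N - q * S11 (0,1,1)%N (0,1,1)%N /\
  H [:: 4; 1; 3]%N = S11 (0,1,1)%N (0,0,0)%N - q * S11 (1,1,1)%N (0,0,1)%N /\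
  H [:: 3; 3; 2]%N = S11 (0,0,0)%N (0,0,1)%N - q * S11 (0,0,1)%N (0,1,1)%N /\
  H [:: 4; 4; 0]%N = S11 (1,0,0)%N (0,1,1)%N - q * S11 (1,0,1)%N (1,1,1)%N
                   + q * z * S11 (2,1,1)%N (0,0,0)%N.
Proof.
do 14 (apply: conj; [by S11_eq|]); by S11_eq.
Qed.
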